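(* Let $\mathfrak{T}_{\lambda_\infty}$ be the set of admissible translations of $(\mathbb{R}_I^\infty,\mathfrak{B}[\mathbb{R}_I^\infty],\lambda_\infty)$, i.e. the set of $x\in\mathbb{R}^\infty$ such that $\lambda_\infty[A-x]=\lambda_\infty[A]$ for all $A\in\mathfrak{B}[\mathbb{R}_I^\infty]$. Then $\mathfrak{T}_{\lambda_\infty}=\ell_1$.
   Context: The space $\mathbb{R}_I^\infty$: let $I=[-\frac12,\frac12]$, $I_n=\prod_{i\ge n+1}I$, $\mathbb{R}_I^n=\mathbb{R}^n\times I_n\subset\mathbb{R}^\infty$ (all real sequences), $X_1=\bigcup_n\mathbb{R}_I^n$, $X_2=\mathbb{R}^\infty\setminus X_1$. $\tau_1$ is the topology on $X_1$ generated by all sets $U\times I_n$ with $n\ge1$ and $U$ open in $\mathbb{R}^n$; $\tau_2$ is the discrete topology on $X_2$; $\tau$ is the disjoint-sum topology, and $\mathbb{R}_I^\infty=(\mathbb{R}^\infty,\tau)$. $\mathfrak{B}(\mathbb{R}_I^n)$ is the $\sigma$-algebra on $\mathbb{R}^n_I$ generated by the sets $U\times I_n$, $U\subset\mathbb{R}^n$ open; $\mathfrak{B}[\mathbb{R}_I^\infty]$ is the $\sigma$-algebra generated by $\bigcup_n\mathfrak{B}(\mathbb{R}_I^n)$ and all subsets of $X_2$ (it is the Borel $\sigma$-algebra of $\tau$). The measure $\lambda_\infty$: for Borel $A\subset\mathbb{R}^n$ put $\lambda_\infty(A\times I_n)=\lambda_n(A)$, $\lambda_n$ being Lebesgue measure.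 Let $\Delta_0$ be the family of sets $K\times I_n$ with $n\ge1$, $K\subset\mathbb{R}^n$ compact and $0<\lambda_\infty(K\times I_n)<\infty$; let $\Delta$ be the family of finite unions $P_N=\bigcup_{i=1}^N K_{n_i}$ of members of $\Delta_0$ with $\lambda_\infty(K_{n_l}\cap K_{n_m})=0$ for $l\ne m$, and $\lambda_\infty(P_N)=\sum_i\lambda_\infty(K_{n_i})$. For open $G$, $\lambda_\infty(G)=\sup\{\lambda_\infty(P_N):P_N\in\Delta,\ P_N\subset G\}$; for compact $F$, $\lambda_\infty(F)=\inf\{\lambda_\infty(G):F\subset G,\ G\text{ open}\}$. For $A\subset\mathbb{R}_I^\infty$, $\lambda_\infty^*(A)=\inf\{\lambda_\infty(G):A\subset G,\ G\text{ open}\}$ and $\lambda_{\infty,( * )}(A)=\sup\{\lambda_\infty(F):F\subset A,\ F\text{ compact}\}$. $\mathfrak{L}_0$ is the class of $A$ with $\lambda_\infty^*(A)=\lambda_{\infty,( * )}(A)<\infty$, and then $\lambda_\infty(A)=\lambda_\infty^*(A)$. A set $A$ is measurable if $A\cap M\in\mathfrak{L}_0$ for all $M\in\mathfrak{L}_0$, with $\lambda_\infty(A)=\sup\{\lambda_\infty(A\cap M):M\in\mathfrak{L}_0\}$; $\mathfrak{L}_I^\infty$ denotes the class of measurable sets, and it is the completion of $\mathfrak{B}[\mathbb{R}_I^\infty]$. By convention $\mathfrak{B}[\mathbb{R}_I^\infty]$ is also used to denote this completion. *)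

(* Defs.v *)
From HB Require Import structures.
From mathcomp Require Import all_boot all_order all_algebra.
From mathcomp Require Import all_classical all_reals all_analysis.

Set Implicit Arguments.
Unset Strict Implicit.
Unset Printing Implicit Defensive.

Import Order.TTheory GRing.Theory Num.Theory.
Import numFieldNormedType.Exports.

Local Open Scope classical_set_scope.
Local Open Scope ring_scope.

(* The measurable structure on n-tuples is the product (= Borel) one. *)
Notation Rtuple R n := (n.-tuple (measurableTypeR R)).

Section LebesgueStep.
Local Open Scope ereal_scope.
Context {R : realType} {n : nat}.
Variable mu : {sigma_finite_measure set (Rtuple R n) -> \bar R}.

Definition tcons (p : measurableTypeR R * Rtuple R n) : Rtuple R n.+1 :=
  [tuple of p.1 :: p.2].

Lemma measurable_tcons : measurable_fun [set: _] tcons.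
Proof. exact: measurable_cons. Qed.

Definition lebesgue_step : set (Rtuple R n.+1) -> \bar R :=
  pushforward (@lebesgue_measure R \x mu) tcons.

Let lebesgue_step0 : lebesgue_step set0 = 0.
Proof. by rewrite /lebesgue_step /pushforward preimage_set0 measure0. Qed.

Let lebesgue_step_ge0 A : 0 <= lebesgue_step A.
Proof. by rewrite /lebesgue_step /pushforward; exact: integral_ge0. Qed.

Let lebesgue_step_sigma_additive : semi_sigma_additive lebesgue_step.
Proof.
exact: (@measure_semi_sigma_additive _ _ _
  (measure_function_pushforward__canonical__measure_function_Measure
    (@lebesgue_measure R \x mu) measurable_tcons)).
Qed.

HB.instance Definition _ := isMeasure.Build _ _ _ lebesgue_step
  lebesgue_step0 lebesgue_step_ge0 lebesgue_step_sigma_additive.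

Let lebesgue_step_sigma_finite : sigma_finite [set: Rtuple R n.+1] lebesgue_step.
Proof.
have /sigma_finiteP[F [TF ndF Foo]] := sigma_finiteT (@lebesgue_measure R).
have /sigma_finiteP[G [TG ndG Goo]] := sigma_finiteT mu.
pose H k := [set t : Rtuple R n.+1 | F k (thead t)] `&`
            [set t : Rtuple R n.+1 | G k [tuple of behead t]].
exists H.
  apply/seteqP; split=> // t _.
  have [i _ Fi] : (\bigcup_i F i) (thead t) by rewrite -TF.
  have [j _ Gj] : (\bigcup_i G i) [tuple of behead t] by rewrite -TG.
  exists (maxn i j) => //; split=> /=.
    by move/subsetPset : (ndF _ _ (leq_maxl i j)); apply.
  by move/subsetPset : (ndG _ _ (leq_maxr i j)); apply.
move=> k; have [mF Fk] := Foo k; have [mG Gk] := Goo k; split.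
  apply: measurableI.
    by rewrite -[X in measurable X]setTI; exact: measurable_tnth.
  by rewrite -[X in measurable X]setTI; exact: measurable_behead.
rewrite /lebesgue_step /pushforward.
have -> : tcons @^-1` H k = F k `*` G k.
  apply/seteqP; split=> -[x t] /=; rewrite /H /= theadE.
    by move=> [? G']; split=> //; congr (G k _) : G'; apply/val_inj.
  by move=> [? G']; split=> //; congr (G k _) : G'; apply/val_inj.
rewrite product_measure1E//.
by apply: lte_mul_pinfty => //; rewrite ge0_fin_numE.
Qed.

HB.instance Definition _ :=
  Measure_isSigmaFinite.Build _ _ _ lebesgue_step lebesgue_step_sigma_finite.

End LebesgueStep.

(* Lebesgue measure on R^n, as the n-fold product of [lebesgue_measure] *)
Fixpoint lebesgue_tuple (R : realType) (n : nat) :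
    {sigma_finite_measure set (Rtuple R n) -> \bar R} :=
  match n with
  | 0 => \d_([tuple] : Rtuple R 0)
  | m.+1 => lebesgue_step (lebesgue_tuple R m)
  end.

Definition lebesgue_rV (R : realType) (n : nat) (A : set 'rV[R]_n) : \bar R :=
  lebesgue_tuple R n [set t | A (\row_i tnth t i)].

(* R^infinity; an alias of [nat -> R], so as to carry the topology tau below.
   Coordinates are numbered from 0. *)
Definition Rinfty (R : realType) := nat -> R.

HB.instance Definition _ (R : realType) := Choice.copy (Rinfty R) (nat -> R).

Section Space.
Context (R : realType).

(* A x I_n *)
Definition cylinder (n : nat) (A : set 'rV[R]_n) : set (Rinfty R) :=
  [set x : Rinfty R | A (\row_(i < n) x i) /\
           forall i, (n <= i)%N -> x i \in `[(- 2^-1)%R, 2^-1%R]].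

Definition X1 : set (Rinfty R) :=
  \bigcup_(n in [set n | (1 <= n)%N]) cylinder (@setT 'rV[R]_n).

Definition X2 : set (Rinfty R) := ~` X1.

Definition topology_on (X : set (Rinfty R)) (O : set_system (Rinfty R)) :=
  [/\ O `<=` [set G | G `<=` X], O X, setI_closed O &
      forall D : set_system (Rinfty R), D `<=` O -> O (\bigcup_(G in D) G)].

Definition open_cylinders : set_system (Rinfty R) :=
  [set C | exists n (U : set 'rV[R]_n),
             [/\ (1 <= n)%N, open U & C = cylinder U]].

Definition tau1 : set_system (Rinfty R) :=
  smallest (topology_on X1) open_cylinders.

Definition tau2 : set_system (Rinfty R) := [set G | G `<=` X2].

Definition tau : set_system (Rinfty R) :=
  [set G | tau1 (G `&` X1) /\ tau2 (G `&` X2)].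

Let tau1T : topology_on X1 tau1.
Proof.
split.
- apply: smallest_sub; last first.
    move=> _ [n [U [n1 _ ->]]] x [_ xI]; by exists n.
  split=> //=; first by move=> A B /= AX BX x [/AX].
  by move=> D DX x [G /DX]; apply.
- by move=> O [[]].
- move=> A B tA tB O OP; have [[_ _ OI _] _] := OP.
  by apply: OI; [exact: tA|exact: tB].
- move=> D Dt O OP; have [[_ _ _ OU] _] := OP.
  by apply: OU => G /Dt; apply.
Qed.

Let tauT : tau setT.
Proof. by split; [rewrite setTI; case: tau1T|exact: subIsetr]. Qed.

Let tauI : setI_closed tau.
Proof.
move=> A B [A1 _] [B1 _]; split; last exact: subIsetr.
by rewrite setIIl; case: tau1T => _ _ + _; apply.
Qed.

Let tau_bigU (I : Type) (f : I -> set (Rinfty R)) :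
  (forall i, tau (f i)) -> tau (\bigcup_i f i).
Proof.
move=> tf; split; last exact: subIsetr.
rewrite setI_bigcupl.
have -> : \bigcup_i (f i `&` X1) =
          \bigcup_(G in range (fun i => f i `&` X1)) G.
  by rewrite bigcup_image.
case: tau1T => _ _ _; apply => _ [i _ <-].
by have [] := tf i.
Qed.

HB.instance Definition _ :=
  isOpenTopological.Build (Rinfty R) tauT tauI tau_bigU.

End Space.

Lemma open_tau (R : realType) : @open (Rinfty R) = @tau R.
Proof. by []. Qed.

Section Measure.
Local Open Scope ereal_scope.
Context (R : realType).
Implicit Types (A C F G K M P : set (Rinfty R)).

Definition borel_rV (n : nat) : set_system 'rV[R]_n := <<s open >>.

(* lambda_oo (B x I_n) = lambda_n B; the default 0 plays no role
   below, because the intersection of two cylinders is again a cylinder. *)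
Definition lambda_cyl C : \bar R :=
  xget 0 [set v | exists n (B : set 'rV[R]_n),
    [/\ (1 <= n)%N, borel_rV B, C = cylinder B & v = lebesgue_rV B]].

Definition Delta0 : set_system (Rinfty R) :=
  [set C | exists n (K : set 'rV[R]_n),
    [/\ (1 <= n)%N, compact K, C = cylinder K & 0 < lambda_cyl C < +oo]].

(* [Delta P v]: P is in Delta and lambda_oo P = v. The empty union (N = 0) is
   allowed, so that open sets containing no element of Delta_0 get measure 0. *)
Definition Delta P (v : \bar R) :=
  exists (N : nat) (K : 'I_N -> set (Rinfty R)),
    [/\ forall i, Delta0 (K i),
        forall l m, l != m -> lambda_cyl (K l `&` K m) = 0,
        P = \bigcup_i K i &
        v = \sum_(i < N) lambda_cyl (K i)].

Definition lambda_open G : \bar R :=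
  ereal_sup [set v | exists2 P, Delta P v & P `<=` G].

Definition lambda_compact F : \bar R :=
  ereal_inf [set lambda_open G | G in [set G | open G /\ F `<=` G]].

Definition lambda_outer A : \bar R :=
  ereal_inf [set lambda_open G | G in [set G | open G /\ A `<=` G]].

Definition lambda_inner A : \bar R :=
  ereal_sup [set lambda_compact F | F in [set F | compact F /\ F `<=` A]].

Definition L0 : set_system (Rinfty R) :=
  [set A | lambda_outer A = lambda_inner A /\ lambda_outer A < +oo].

(* The measurable sets: the completion of the Borel sigma-algebra of tau, on
   which lambda_infty below is a measure. *)
Definition Linfty : set_system (Rinfty R) :=
  [set A | forall M, L0 M -> L0 (A `&` M)].

Definition lambda_infty A : \bar R :=
  ereal_sup [set lambda_outer (A `&` M) | M in L0].

(* A - x *)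
Definition translate_sub A (x : Rinfty R) : set (Rinfty R) :=
  [set (fun i => (a i - x i)%R) | a in A].

(* lambda_infty (A - x) only makes sense if A - x is measurable, hence the
   explicit measurability requirement. *)
Definition admissible_translations : set (Rinfty R) :=
  [set x | forall A, Linfty A ->
     Linfty (translate_sub A x) /\
     lambda_infty (translate_sub A x) = lambda_infty A].

Definition ell1 : set (Rinfty R) :=
  [set x | \sum_(0 <= i <oo) `|x i|%:E < +oo].

End Measure.

Arguments admissible_translations R : clear implicits.
Arguments ell1 R : clear implicits.

(* Main.v *)
Require Import Defs.
From HB Require Import structures.
From mathcomp Require Import all_boot all_order all_algebra.
From mathcomp Require Import all_classical all_reals all_analysis.
From mathcomp Require Import measurable_realfun.
From mathcomp Require Import zify lra.

Set Implicit Arguments.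
Unset Strict Implicit.
Unset Printing Implicit Defensive.

Import Order.TTheory GRing.Theory Num.Theory.
Import numFieldNormedType.Exports.

Local Open Scope classical_set_scope.
Local Open Scope ring_scope.

(** Let I = [-1/2, 1/2] and T_n = R^n x I_n.  Each T_n with n >= 1 is open for
tau, so X1 is the disjoint sum of T_1 and of the pieces T_n minus T_(n-1) for
n >= 2, on each of which tau is the product topology; the measure of an open
set is the supremum of the measures of the compact cylinders inside it, and X2
is null.

Summable translations are admissible.  Let x be summable and let C be a cylinder
B x I_n.  A point b of X1 with b + x in C has, for any m >= n, either all its
coordinates of index >= m in I, or a last coordinate i >= m outside I.  The
points of the first kind form a cylinder of dimension m whose base is a
translate of B x I^(m-n), hence of measure lambda(C).  Those of the second
kind, for a given i, form a set of measure at most lambda(C) |x_i|, because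
I and I + x_i differ by so little.  Letting m tend to infinity, the translate
of C has outer measure at most lambda(C) ([lambda_outer_preshift_diff]).  An
open set is, up to X2, a countable disjoint union of differences of compact
cylinders, whose measures add up; and the translate of X2 meets X1 in a null
set for the same reason as above.  So the outer measure does not increase
under translation by x, and using -x as well, it is invariant
([lambda_outer_preshift]).  For the inner measure, the translate of a compact
set F need not be compact, since tau jumps where a coordinate crosses the
boundary of I; but it is compact once the points of F whose translate comes
too close to such a crossing, or has a coordinate of large index outside I,
have been removed, and these carry little measure ([compact_preshift_approx]).
Measurability and lambda_infty are defined from the outer and inner measures
alone, so they are invariant too.

Conversely let x not be summable.  The set T_1 is open and closed, hence
measurable, and it contains the compact set T_0, the product of all the I's,
of measure 1.  But for a point b of X1 in the translate of T_1, there is an index n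
from which on both b_i and b_i + x_i are in I; within a bounded box of T_n, the
measure of the points b with b_i + x_i in I for n <= i < N is at most a constant
times the product of the exp(- |x_i|), which tends to 0.  So the translate of T_1 is null.

The outer measure is countably subadditive ([lambda_open_bigcup]) because a
compact cylinder, after removal of a set of small measure around the jumps of
tau, is compact for tau; a finite subcover by cylinders then reduces the
inequality to Lebesgue measure on some R^M. *)

(** * Lebesgue measure on R^n: products and translations *)

Section FiniteDim.
Context (R : realType).
Local Open Scope ereal_scope.
Local Notation leb := (@lebesgue_measure R).

Lemma measurable_tuple_section n (A : set (Rtuple R n.+1)) (x : R) :
  measurable A -> measurable [set t : Rtuple R n | A (tcons (x, t))].
Proof.
move=> mA; rewrite -[X in measurable X]setTI.
have : measurable_fun setT (fun t : Rtuple R n => tcons (x, t)).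
  apply: (@measurable_cons _ _ (Rtuple R n) (measurableTypeR R) (fun=> x) n idfun).
  - exact: measurable_cst.
  - exact: measurable_id.
by move=> /(_ measurableT _ mA).
Qed.

Lemma lebesgue_tupleS n (A : set (Rtuple R n.+1)) :
  lebesgue_tuple R n.+1 A =
  \int[leb]_x lebesgue_tuple R n [set t | A (tcons (x, t))].
Proof.
rewrite /= /lebesgue_step /pushforward /product_measure1 /=.
apply: eq_integral => x _; congr (lebesgue_tuple R n _).
by apply/seteqP; split => t; rewrite /xsection/= inE.
Qed.

Lemma measurable_lebesgue_tuple_section n (A : set (Rtuple R n.+1)) :
  measurable A ->
  measurable_fun setT
    (fun x : measurableTypeR R => lebesgue_tuple R n [set t | A (tcons (x, t))]).
Proof.
move=> mA.
have mB : measurable (@tcons R n @^-1` A).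
  by rewrite -[X in measurable X]setTI; exact: measurable_tcons.
have := measurable_fun_xsection (lebesgue_tuple R n) mB.
apply: eq_measurable_fun => x _ /=; congr (lebesgue_tuple R n _).
by apply/seteqP; split => t; rewrite /xsection/= inE.
Qed.

Definition tuple_front n (t : Rtuple R n.+1) : Rtuple R n :=
  [tuple tnth t (widen_ord (leqnSn n) i) | i < n].

Lemma tuple_front_tcons n (x : R) (t : Rtuple R n.+1) :
  tuple_front (tcons (x, t)) = tcons (x, tuple_front t).
Proof.
apply: eq_from_tnth => i; rewrite tnth_mktuple !(tnth_nth 0%R) /=.
case: i => -[|i] //= Hi.
by rewrite (nth_map (Ordinal (Hi : (i < n)%N))) ?size_enum_ord//
  (tnth_nth 0%R)/= nth_enum_ord.
Qed.

(** The recursion defining the measure splits off the first coordinate, whereas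
cylinders grow by their last one; hence the induction on sections. *)
Lemma lebesgue_tuple_prod n (A : set (Rtuple R n)) (J : set (measurableTypeR R)) :
  measurable A -> measurable J ->
  lebesgue_tuple R n.+1 [set t | A (tuple_front t) /\ J (tnth t ord_max)] =
  lebesgue_tuple R n A * leb J.
Proof.
elim: n A => [|n IH] A mA mJ.
  rewrite lebesgue_tupleS /=.
  transitivity (\int[leb]_x (\d_([tuple] : Rtuple R 0) A * (\1_J x)%:E)).
    apply: eq_integral => x _; rewrite !diracE indicE -EFinM -natrM mulnb.
    congr ((nat_of_bool _)%:R%:E); apply/idP/andP; rewrite !inE /=.
      by move=> -[]; rewrite (tuple0 (tuple_front _)).
    by move=> -[]; rewrite (tuple0 (tuple_front _)).
  rewrite ge0_integralZl ?integral_indic ?setIT//.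
  exact/measurable_EFinP/measurable_indic.
rewrite lebesgue_tupleS.
under eq_integral => x _.
  rewrite (_ : [set t | _] =
    [set t | A (tcons (x, tuple_front t)) /\ J (tnth t ord_max)]); last first.
    apply/seteqP; split => t /=; rewrite tuple_front_tcons
      (_ : tnth (tcons (x, t)) ord_max = tnth t ord_max) //;
      by rewrite !(tnth_nth 0%R).
  rewrite (IH [set t | A (tcons (x, t))]) //; last exact: measurable_tuple_section.
  over.
rewrite ge0_integralZr ?lebesgue_tupleS//.
exact: measurable_lebesgue_tuple_section.
Qed.

Definition tadd n (v t : Rtuple R n) : Rtuple R n :=
  [tuple tnth t i + tnth v i | i < n]%R.

(** The translated measure agrees with Lebesgue measure on half-open intervals. *)
Lemma lebesgue_measure_shift (r : R) (A : set (measurableTypeR R)) :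
  measurable A -> leb [set x | A (x + r)%R] = leb A.
Proof.
move=> mA.
have mf : measurable_fun setT (fun x : measurableTypeR R => (x + r)%R : measurableTypeR R).
  by apply: measurable_funD => //.
apply/esym; rewrite -[RHS]/(pushforward leb _ A).
pose m : {measure set (measurableTypeR R) -> \bar R} :=
  measure_function_pushforward__canonical__measure_function_Measure leb mf.
rewrite -[RHS]/(m A); apply: lebesgue_measure_unique => // X [[a b] /= _ <-].
rewrite /m /=.
rewrite /pushforward /=.
rewrite (_ : _ @^-1` _ = `](a - r)%R, (b - r)%R]%classic).
  rewrite !lebesgue_measure_itv /= !lte_fin ltrD2r; case: ifP => // _.
  by rewrite -!EFinB; congr EFin; lra.
by apply/seteqP; split => x /=; rewrite !in_itv /=; lra.
Qed.

Lemma lebesgue_tuple_shift n (v : Rtuple R n) (A : set (Rtuple R n)) :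
  measurable A ->
  lebesgue_tuple R n (tadd v @^-1` A) = lebesgue_tuple R n A.
Proof.
elim: n v A => [|n IH] v A mA.
  by congr (_ _); apply/funext => t /=; congr A; apply: eq_from_tnth => -[].
rewrite !lebesgue_tupleS.
pose f (x : measurableTypeR R) := lebesgue_tuple R n [set t | A (tcons (x, t))].
transitivity (\int[leb]_x f (x + thead v)%R).
  apply: eq_integral => x _.
  rewrite /f -[RHS](IH [tuple of behead v]); last exact: measurable_tuple_section.
  congr (lebesgue_tuple _ _ _).
  suff E t : tadd v (tcons (x, t)) = tcons (x + thead v, tadd [tuple of behead v] t)%R.
    by apply/seteqP; split => t /=; rewrite E.
  apply: eq_from_tnth => i; rewrite tnth_mktuple; case: (unliftP ord0 i) => [j|] ->.
    by rewrite !tnthS tnth_mktuple !(tnth_nth 0%R) /= nth_behead.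
  by [].
have mf : measurable_fun setT (fun x : measurableTypeR R => (x + thead v)%R : measurableTypeR R).
  by apply: measurable_funD => //.
rewrite -[LHS](@ge0_integral_pushforward _ _ _ _ _ _ mf leb setT f)//;
  last exact: measurable_lebesgue_tuple_section.
apply: eq_measure_integral => B mB _; exact: lebesgue_measure_shift.
Qed.
End FiniteDim.

(** * Cylinders and their measure *)

Section Cylinders.
Context (R : realType).
Local Notation leb := (@lebesgue_measure R).
Local Notation E := (Rinfty R).
Implicit Types (a b l x : E) (S : set E) (n m k : nat).

(** T_n = R^n x I_n; in particular T_0 is the product of all the intervals I. *)
Definition tail n : set E := [set a | forall i, (n <= i)%N -> `|a i| <= 2^-1].

Definition trunc n (a : E) : E := fun i => if (i < n)%N then a i else 0.

(** The filler 0 lies in I, so that a tuple becomes a point of T_n. Cylinders of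
all dimensions are thus subsets of one type, and no change of dimension needs a
cast. *)
Definition pad n (t : Rtuple R n) : E := fun i => nth 0 t i.

(** S is B x I_n for some subset B of R^n. *)
Definition is_cyl n S := S `<=` tail n /\
  forall a b, S a -> tail n b -> (forall i, (i < n)%N -> a i = b i) -> S b.

Definition mcyl n S := is_cyl n S /\ measurable (@pad n @^-1` S).

Definition mu n S : \bar R := lebesgue_tuple R n (@pad n @^-1` S).

Definition addE (a x : E) : E := fun i => a i + x i.

Lemma half_ge0 : 0 <= 2^-1 :> R. Proof. by rewrite invr_ge0. Qed.

Lemma tail_trunc n m a : (n <= m)%N -> tail n a -> tail n (trunc m a).
Proof.
move=> nm ta i ni; rewrite /trunc; case: ifP => _; first exact: ta.
by rewrite normr0 half_ge0.
Qed.

Lemma tail_truncT n a : tail n (trunc n a).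
Proof. by move=> i ni; rewrite /trunc ltnNge ni /= normr0 half_ge0. Qed.

Lemma tail_pad n (t : Rtuple R n) : tail n (pad t).
Proof. by move=> i ni; rewrite /pad nth_default ?size_tuple// normr0 half_ge0. Qed.

Lemma tailS n m : (n <= m)%N -> tail n `<=` tail m.
Proof. by move=> nm a ta i mi; apply: ta; exact: leq_trans mi. Qed.

Lemma is_cylW n m S : (n <= m)%N -> is_cyl n S -> is_cyl m S.
Proof.
move=> nm [ST cS]; split; first by move=> a /ST /tailS; exact.
move=> a b Sa tb ab; apply: (cS a) => //.
  move=> i ni; have [mi|im] := leqP m i; first exact: tb.
  by rewrite -ab//; exact: ST ni.
by move=> i im; apply: ab; exact: leq_trans nm.
Qed.

Lemma is_cylI n S S' : is_cyl n S -> is_cyl n S' -> is_cyl n (S `&` S').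
Proof.
move=> [ST cS] [_ cS']; split; first by move=> a [/ST].
by move=> a b [Sa S'a] tb ab; split; [exact: (cS a)|exact: (cS' a)].
Qed.

Lemma is_cylU n S S' : is_cyl n S -> is_cyl n S' -> is_cyl n (S `|` S').
Proof.
move=> [ST cS] [ST' cS']; split; first by move=> a [/ST|/ST'].
by move=> a b [/cS|/cS'] h tb ab; [left|right]; exact: h.
Qed.

Lemma is_cylD n S S' : is_cyl n S -> is_cyl n S' -> is_cyl n (S `\` S').
Proof.
move=> [ST cS] [ST' cS']; split; first by move=> a [/ST].
move=> a b [Sa S'a] tb ab; split; first exact: (cS a).
by move=> S'b; apply/S'a/(cS' b) => //; [exact: ST|move=> i /ab].
Qed.

Lemma mcylI n S S' : mcyl n S -> mcyl n S' -> mcyl n (S `&` S').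
Proof.
by move=> [? ?] [? ?]; split; [exact: is_cylI|rewrite preimage_setI; exact: measurableI].
Qed.

Lemma mcylU n S S' : mcyl n S -> mcyl n S' -> mcyl n (S `|` S').
Proof.
by move=> [? ?] [? ?]; split; [exact: is_cylU|rewrite preimage_setU; exact: measurableU].
Qed.

Lemma mcylD n S S' : mcyl n S -> mcyl n S' -> mcyl n (S `\` S').
Proof.
move=> [? ?] [? ?]; split; first exact: is_cylD.
by rewrite setDE preimage_setI preimage_setC -setDE; exact: measurableD.
Qed.

Lemma le_mu n S S' : mcyl n S -> mcyl n S' -> S `<=` S' -> (mu n S <= mu n S')%E.
Proof.
by move=> [_ ?] [_ ?] SS'; apply: le_measure; rewrite ?inE// => t /SS'.
Qed.

(** (B x J) x I_(n+1) for S = B x I_n. *)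
Definition cyl_prod n S (J : set R) : set E :=
  [set a | [/\ tail n.+1 a, S (trunc n a) & J (a n)]].

Lemma trunc_padS n (t : Rtuple R n.+1) : trunc n (pad t) = pad (tuple_front t).
Proof.
apply/funext => i; rewrite /trunc /pad; case: ltnP => [lin|ni]; last first.
  by rewrite nth_default ?size_tuple.
have -> : nth 0 (tuple_front t) i = tnth (tuple_front t) (Ordinal lin).
  by rewrite (tnth_nth 0).
by rewrite tnth_mktuple (tnth_nth 0).
Qed.

Lemma pad_cyl_prod n S J : @pad n.+1 @^-1` (cyl_prod n S J) =
  [set t | (@pad n @^-1` S) (tuple_front t) /\ J (tnth t ord_max)].
Proof.
apply/seteqP; split => t /=; rewrite /cyl_prod /= trunc_padS (tnth_nth 0) /=.
  by case.
by case => ? ?; split => //; exact: tail_pad.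
Qed.

Lemma measurable_tuple_front n : measurable_fun setT (@tuple_front R n).
Proof.
apply/measurable_fun_tnthP => i.
rewrite (_ : _ \o _ = (fun t : Rtuple R n.+1 => tnth t (widen_ord (leqnSn n) i))).
  exact: measurable_tnth.
by apply/funext => t; rewrite /= tnth_mktuple.
Qed.

Lemma mcyl_prod n S (J : set (measurableTypeR R)) :
  mcyl n S -> measurable J -> mcyl n.+1 (cyl_prod n S J).
Proof.
move=> [cS mS] mJ; split; last first.
  rewrite pad_cyl_prod; apply: measurableI.
    by rewrite -[X in measurable X]setTI; exact: measurable_tuple_front.
  by rewrite -[X in measurable X]setTI; exact: measurable_tnth.
split; first by move=> a [].
move=> a b [ta Sa Ja] tb ab; split => //; last by rewrite -ab.
apply: cS.2 Sa (@tail_truncT _ _) _ => i lin; rewrite /trunc lin ab//.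
exact: ltnW.
Qed.

Lemma mu_prod n S (J : set (measurableTypeR R)) : mcyl n S -> measurable J ->
  mu n.+1 (cyl_prod n S J) = (mu n S * leb J)%E.
Proof.
by move=> [cS mS] mJ; rewrite /mu pad_cyl_prod lebesgue_tuple_prod.
Qed.

Definition Iset : set (measurableTypeR R) := `[(- 2^-1)%R, 2^-1%R]%classic.

Lemma IsetE (r : R) : Iset r <-> `|r| <= 2^-1.
Proof. by rewrite /Iset /= in_itv /= ler_norml. Qed.

Lemma measurable_Iset : measurable Iset. Proof. exact: measurable_itv. Qed.
Hint Resolve measurable_Iset : core.

Lemma cyl_prodE n S (J : set R) : is_cyl n S -> J `<=` Iset ->
  cyl_prod n S J = S `&` [set a | J (a n)].
Proof.
move=> [ST cS] JI; apply/seteqP; split => a.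
  move=> [ta Sa Ja]; split => //; apply: (cS _ _ Sa); last first.
    by move=> i lin; rewrite /trunc lin.
  move=> i; rewrite leq_eqVlt => /predU1P[<-|]; last exact: ta.
  exact/IsetE/JI.
move=> [Sa Ja]; split => //; first by apply: tailS (ST _ Sa).
apply: (cS _ _ Sa); first exact: tail_truncT.
by move=> i lin; rewrite /trunc lin.
Qed.

Lemma leb_Iset : leb Iset = 1%E.
Proof.
rewrite /Iset lebesgue_measure_itv /= lte_fin.
have -> : (- 2^-1 < 2^-1 :> R) by lra.
by rewrite -EFinB; congr EFin; lra.
Qed.

Lemma cyl_prodI n S : is_cyl n S -> cyl_prod n S Iset = S.
Proof.
move=> cS; rewrite cyl_prodE//; apply/setIidl => a Sa.
by apply/IsetE; apply: cS.1 Sa _ _.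
Qed.

Lemma mcylS n S : mcyl n S -> mcyl n.+1 S.
Proof. by move=> mS; rewrite -(cyl_prodI mS.1); exact: mcyl_prod. Qed.

Lemma mcylW n m S : (n <= m)%N -> mcyl n S -> mcyl m S.
Proof.
by move=> /subnK <- mS; elim: (m - n)%N => // k /mcylS; rewrite addSn.
Qed.

(** B x I_n = (B x I) x I_(n+1), and I has length 1. *)
Lemma muW n m S : (n <= m)%N -> mcyl n S -> mu m S = mu n S.
Proof.
move=> /subnK <- mS; elim: (m - n)%N => // k <-; rewrite addSn.
have mS' := mcylW (leq_addl k n) mS.
by rewrite -{1}(cyl_prodI mS'.1) mu_prod// leb_Iset mule1.
Qed.

Lemma mu_eq n m S : mcyl n S -> mcyl m S -> mu n S = mu m S.
Proof.
move=> mS mS'; rewrite -(muW (leq_maxl n m) mS).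
exact: (muW (leq_maxr n m) mS').
Qed.

(** (B - x) x I_n for S = B x I_n: only the first n coordinates are translated. *)
Definition shift_cyl n x S : set E := [set a | tail n a /\ S (trunc n (addE a x))].

Lemma pad_shift_cyl n x S :
  @pad n @^-1` (shift_cyl n x S) =
  tadd [tuple x i | i < n] @^-1` (@pad n @^-1` S).
Proof.
have e t : trunc n (addE (pad t) x) = pad (tadd [tuple x i | i < n] t).
  apply/funext => i; rewrite /trunc /pad; case: ltnP => [lin|ni]; last first.
    by rewrite nth_default ?size_tuple.
  have -> : nth 0 (tadd [tuple x i | i < n] t) i =
      tnth (tadd [tuple x i | i < n] t) (Ordinal lin) by rewrite (tnth_nth 0).
  by rewrite !tnth_mktuple (tnth_nth 0).
apply/seteqP; split => t /=; rewrite /shift_cyl /= e; first by case.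
by move=> ?; split => //; exact: tail_pad.
Qed.

Lemma mu_shift n x S : mcyl n S -> mu n (shift_cyl n x S) = mu n S.
Proof. by move=> [_ mS]; rewrite /mu pad_shift_cyl lebesgue_tuple_shift. Qed.

Definition coord_close n (e : R) a b := forall i, (i < n)%N -> `|a i - b i| < e.

(** [ocyl], [fcyl] and [kcyl] say that the base of the cylinder is open, closed
or compact in R^n. Closed and compact bases keep that property when the
dimension is raised ([fcylW], [kcylW]); open ones do not, because I is not
open. *)
Definition ocyl n S := is_cyl n S /\
  forall a, S a -> exists2 e : R, 0 < e & forall b, tail n b -> coord_close n e a b -> S b.

Definition fcyl n S := is_cyl n S /\
  forall l, tail n l -> (forall e : R, 0 < e -> exists2 a, S a & coord_close n e a l) -> S l.

Definition bounded_cyl n S := exists c : R, forall a i, S a -> (i < n)%N -> `|a i| <= c.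

Definition kcyl n S := fcyl n S /\ bounded_cyl n S.

(** Only k coordinates are constrained, while membership in [tail n] is required
for a possibly smaller n; this is what neighbourhoods for tau look like. *)
Definition rat_box n k j (q : seq rat) : set E :=
  [set b | tail n b /\ forall i, (i < k)%N -> `|b i - ratr (nth 0 q i)| < j.+1%:R^-1].

Definition closed_rat_box n k j (q : seq rat) : set E :=
  [set b | tail n b /\ forall i, (i < k)%N -> `|b i - ratr (nth 0 q i)| <= j.+1%:R^-1].

Lemma rational_approx a k (e : R) : 0 < e -> exists j q,
  (forall i, (i < k)%N -> `|a i - ratr (nth 0 q i)| < j.+1%:R^-1) /\
  forall b, (forall i, (i < k)%N -> `|b i - ratr (nth 0 q i)| <= j.+1%:R^-1) ->
    coord_close k e a b.
Proof.
move=> e0; have [j je] : exists j, j.+1%:R^-1 < e / 2.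
  have e2 : 0 < e / 2 by rewrite divr_gt0.
  by have [j _ /(_ j (leqnn j))] := near_infty_natSinv_lt (PosNum e2); exists j.
exists j; have j0 : 0 < j.+1%:R^-1 :> R by rewrite invr_gt0.
move: (j.+1%:R^-1) je j0 => d je j0.
have Q (r : R) : exists q : rat, `|r - ratr q| < d.
  have /rat_in_itvoo[q] : r - d < r + d by lra.
  rewrite in_itv /= => /andP[h1 h2]; exists q; rewrite ltr_norml; lra.
pose q i := xget 0 [set q : rat | `|a i - ratr q| < d].
have aq i : `|a i - ratr (q i)| < d.
  exact: (xgetPex 0 (Q (a i))).
exists (mkseq q k); split; first by move=> i ik; rewrite nth_mkseq.
move=> b bq i ik; have := bq i ik; rewrite nth_mkseq// => bqi.
have := aq i; set z := ratr _ in bqi * => aqi.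
have -> : a i - b i = (a i - z) - (b i - z) by lra.
by apply: le_lt_trans (ler_normB _ _) _; lra.
Qed.

Lemma measurable_rat_box n j q : measurable (@pad n @^-1` rat_box n n j q).
Proof.
rewrite (_ : _ @^-1` _ = \bigcap_(i in [set: 'I_n])
  ((fun t : Rtuple R n => tnth t i) @^-1`
     `](ratr (nth 0 q i) - j.+1%:R^-1), (ratr (nth 0 q i) + j.+1%:R^-1)[)).
  apply: fin_bigcap_measurable => // i _.
  by rewrite -[X in measurable X]setTI; exact: measurable_tnth.
apply/seteqP; split => t.
  move=> [_ h] i _ /=; have := h i (ltn_ord i).
  by rewrite in_itv /= (tnth_nth 0) ltr_distl.
move=> h; split; first exact: tail_pad.
move=> i lin; have := h (Ordinal lin) I.
by rewrite /= in_itv /= (tnth_nth 0) ltr_distl.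
Qed.

(** An open subset of R^n is a countable union of rational cubes. *)
Lemma mcyl_ocyl n S : ocyl n S -> mcyl n S.
Proof.
move=> [cS oS]; split => //.
pose B (u : nat) : set (Rtuple R n) := if unpickle u is Some (j, q) then
  if pselect (rat_box n n j q `<=` S) then @pad n @^-1` rat_box n n j q else set0 else set0.
rewrite (_ : _ @^-1` _ = \bigcup_u B u).
  apply: bigcup_measurable => u _; rewrite /B.
  case: unpickle => [[j q]|] //; case: pselect => [h|h] //=.
  exact: measurable_rat_box.
apply/seteqP; split => [t St|t [u _]]; last first.
  by rewrite /B; case: unpickle => [[j q]|] //; case: pselect => [h|_] //; exact: h.
have [e e0 eS] := oS _ St.
have [j [q [h1 h2]]] := rational_approx (pad t) n e0.
exists (pickle (j, q)) => //; rewrite /B pickleK.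
case: pselect => [h|]; first by split => //; exact: tail_pad.
by case=> b [tb bq]; apply: eS => //; apply: h2 => i lin; apply/ltW/bq.
Qed.

Lemma is_cyl_tail n : is_cyl n (tail n).
Proof. by split. Qed.

Lemma ocylD n S S' : ocyl n S -> fcyl n S' -> ocyl n (S `\` S').
Proof.
move=> [cS oS] [cS' fS']; split; first exact: is_cylD.
move=> a [Sa S'a]; have [e e0 eS] := oS a Sa.
have /existsNP[d /not_implyP[d0 dS]] :
    ~ forall e : R, 0 < e -> exists2 b, S' b & coord_close n e b a.
  by move=> h; apply/S'a/fS' => //; exact: cS.1 Sa.
exists (Num.min d e); first by rewrite lt_min d0.
move=> b tb ab; split.
  by apply: eS => // i /ab; rewrite lt_min => /andP[].
move=> S'b; apply: dS; exists b => // i /ab.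
by rewrite lt_min distrC => /andP[].
Qed.

Lemma ocyl_tail n : ocyl n (tail n).
Proof. by split; [exact: is_cyl_tail|move=> a _; exists 1]. Qed.

(** The base of a closed cylinder is the complement of an open one. *)
Lemma mcyl_fcyl n S : fcyl n S -> mcyl n S.
Proof.
move=> fS; have -> : S = tail n `\` (tail n `\` S).
  by rewrite setDD; apply/esym/setIidr; exact: fS.1.1.
apply: mcylD; first exact/mcyl_ocyl/ocyl_tail.
exact/mcyl_ocyl/ocylD/fS/ocyl_tail.
Qed.

Lemma mcyl_kcyl n S : kcyl n S -> mcyl n S. Proof. by move=> [/mcyl_fcyl]. Qed.

Lemma fcylW n m S : (n <= m)%N -> fcyl n S -> fcyl m S.
Proof.
move=> nm [cS fS]; split; first exact: is_cylW cS.
move=> l tl hl; apply: fS; last first.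
  move=> e /hl[a Sa al]; exists a => // i lin; apply: al; exact: leq_trans nm.
move=> i ni; have [mi|im] := leqP m i; first exact: tl.
apply/ler_addgt0Pr => e /hl[a Sa /(_ i im) al].
have := cS.1 _ Sa i ni; have -> : l i = a i - (a i - l i) by lra.
by move=> ?; apply: le_trans (ler_normB _ _) _; lra.
Qed.

Lemma kcylW n m S : (n <= m)%N -> kcyl n S -> kcyl m S.
Proof.
move=> nm [fS [c cS]]; split; first exact: fcylW fS.
exists (Num.max c 2^-1) => a i Sa im; rewrite le_max.
have [ni|lin] := leqP n i; last by rewrite cS.
by rewrite (fS.1.1 _ Sa)// orbT.
Qed.

Lemma fcylI n S S' : fcyl n S -> fcyl n S' -> fcyl n (S `&` S').
Proof.
move=> [cS fS] [cS' fS']; split; first exact: is_cylI.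
by move=> l tl h; split; [apply: fS|apply: fS'] => // e /h[a [? ?] ?]; exists a.
Qed.

Lemma fcylU n S S' : fcyl n S -> fcyl n S' -> fcyl n (S `|` S').
Proof.
move=> [cS fS] [cS' fS']; split; first exact: is_cylU.
move=> l tl h; apply: contrapT => /not_orP[Sl S'l].
have /existsNP[d /not_implyP[d0 dS]] :
    ~ forall e : R, 0 < e -> exists2 b, S b & coord_close n e b l.
  by move=> h1; apply/Sl/fS.
have /existsNP[e /not_implyP[e0 eS]] :
    ~ forall e : R, 0 < e -> exists2 b, S' b & coord_close n e b l.
  by move=> h1; apply/S'l/fS'.
have /h[a [Sa|Sa] al] : 0 < Num.min d e by rewrite lt_min d0.
  by apply: dS; exists a => // i /al; rewrite lt_min => /andP[].
by apply: eS; exists a => // i /al; rewrite lt_min => /andP[].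
Qed.

Lemma kcylI n S S' : kcyl n S -> fcyl n S' -> kcyl n (S `&` S').
Proof.
move=> [fS [c cS]] fS'; split; first exact: fcylI.
by exists c => a i [Sa _]; exact: cS.
Qed.

Lemma kcylU n S S' : kcyl n S -> kcyl n S' -> kcyl n (S `|` S').
Proof.
move=> [fS [c cS]] [fS' [c' cS']]; split; first exact: fcylU.
exists (Num.max c c') => a i [Sa|Sa] lin; rewrite le_max.
  by rewrite (cS a).
by rewrite (cS' a)// orbT.
Qed.

Lemma kcyl0 n : kcyl n set0.
Proof.
split; last by exists 0.
by split => [|l _ /(_ 1 ltr01)[]//]; split => // a b [].
Qed.

Lemma fcyl_shift n x S : fcyl n S -> fcyl n (shift_cyl n x S).
Proof.
move=> [cS fS]; split.
  split; first by move=> a [].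
  move=> a b [ta Sa] tb ab; split => //.
  apply: cS.2 Sa (@tail_truncT _ _) _ => i lin.
  by rewrite /trunc lin /addE ab.
move=> l tl h; split => //; apply: fS; first exact: tail_truncT.
move=> e /h[a [ta Sa] al]; exists (trunc n (addE a x)) => // i lin.
rewrite /trunc lin /addE; have := al i lin.
by rewrite opprD addrACA subrr addr0.
Qed.

Lemma kcyl_shift n x S : kcyl n S -> kcyl n (shift_cyl n x S).
Proof.
move=> [fS [c cS]]; split; first exact: fcyl_shift.
exists (\sum_(i < n) (c + `|x i|)) => a i [ta Sa] lin.
have c0 j : (j < n)%N -> 0 <= c by move=> jn; apply: le_trans (cS _ j Sa jn).
rewrite (bigD1 (Ordinal lin)) //= ler_wpDr ?sumr_ge0//.
  by move=> j _; rewrite addr_ge0 ?(c0 i).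
have := cS _ i Sa lin; rewrite /trunc lin /addE => ?.
have -> : a i = (a i + x i) - x i by lra.
apply: le_trans (ler_normB _ _) _; lra.
Qed.

Definition box n (c : R) : set E :=
  [set a | tail n a /\ forall i, (i < n)%N -> `|a i| <= c].

Lemma kcyl_box n c : kcyl n (box n c).
Proof.
split; last by exists c => a i [_]; exact.
split.
  split; first by move=> a [].
  by move=> a b [_ ac] tb ab; split => // i lin; rewrite -ab// ac.
move=> l tl h; split => // i lin; apply/ler_addgt0Pr => e /h[a [_ /(_ i lin) ac] /(_ i lin) al].
have -> : l i = a i - (a i - l i) by lra.
by apply: le_trans (ler_normB _ _) _; lra.
Qed.

Lemma mu_box_fin n c : (mu n (box n c) < +oo)%E.
Proof.
elim: n => [|n IH].
  by rewrite /mu /= diracE ltry.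
have -> : box n.+1 c = cyl_prod n (box n c) `[-c, c]%classic.
  apply/seteqP; split => a.
    move=> [ta ac]; split => //; last by rewrite /= in_itv /= -ler_norml ac.
    by split=> [|i lin]; [exact: tail_truncT|rewrite /trunc lin ac// ltnW].
  move=> [ta [_ ac] acn]; split => // i; rewrite ltnS leq_eqVlt => /predU1P[->|lin].
    by move: acn; rewrite /= in_itv /= -ler_norml.
  by have := ac i lin; rewrite /trunc lin.
rewrite mu_prod//; last exact/mcyl_kcyl/kcyl_box.
apply: lte_mul_pinfty => //; first by rewrite ge0_fin_numE.
by rewrite lebesgue_measure_itv /=; case: ifP => // _; rewrite -EFinB ltry.
Qed.

Lemma bounded_sub_box n S : is_cyl n S -> bounded_cyl n S -> exists c, S `<=` box n c.
Proof. by move=> cS [c Sc]; exists c => a Sa; split=> [|i]; [exact: cS.1|exact: Sc]. Qed.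

Lemma mu_fin n S : mcyl n S -> bounded_cyl n S -> (mu n S < +oo)%E.
Proof.
move=> mS /(bounded_sub_box mS.1)[c Sc]; apply: le_lt_trans (mu_box_fin n c).
by apply: le_mu Sc => //; exact/mcyl_kcyl/kcyl_box.
Qed.

End Cylinders.

(** * Compact cylinders and the measure of open sets *)

Section Link.
Context (R : realType).
Local Notation E := (Rinfty R).
Implicit Types (a b l x : E) (S : set E) (n m k : nat).

Definition vrow n (a : E) : 'rV[R]_n := \row_(i < n) a i.

(** The analogue of [pad] for row vectors, on which the topology of R^n lives. *)
Definition vpad n (v : 'rV[R]_n) : E :=
  fun i => if insub i is Some j then v ord0 j else 0.

Lemma vpadE n (v : 'rV[R]_n) (i : nat) (lin : (i < n)%N) :
  vpad v i = v ord0 (Ordinal lin).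
Proof. by rewrite /vpad insubT. Qed.

Lemma tail_vpad n (v : 'rV[R]_n) : tail n (vpad v).
Proof. by move=> i ni; rewrite /vpad insubF ?normr0 ?half_ge0// ltnNge ni. Qed.

Lemma vrowK n a i : (i < n)%N -> vpad (vrow n a) i = a i.
Proof. by move=> lin; rewrite vpadE mxE. Qed.

Lemma cylinderE n (A : set 'rV[R]_n) :
  cylinder A = [set a | A (vrow n a) /\ tail n a].
Proof.
apply/seteqP; split => a [Aa ha]; split => // i ni.
  by apply/IsetE; have := ha i ni.
by have /IsetE := ha i ni.
Qed.

Lemma is_cyl_cylinder n (A : set 'rV[R]_n) : is_cyl n (cylinder A).
Proof.
rewrite cylinderE; split; first by move=> a [].
move=> a b [Aa ta] tb ab; split => //; rewrite (_ : vrow n b = vrow n a)//.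
by apply/rowP => i; rewrite !mxE ab.
Qed.

Lemma cylinder_is_cyl n S : is_cyl n S -> S = cylinder [set v | S (@vpad n v)].
Proof.
move=> cS; rewrite cylinderE; apply/seteqP; split => a.
  move=> Sa; have ta := cS.1 _ Sa; split => //=.
  apply: (cS.2 a) => //; first exact: tail_vpad.
  by move=> i lin; rewrite vrowK.
move=> [/= Sa ta]; apply: (cS.2 _ _ Sa) => // i lin; exact: vrowK.
Qed.

Lemma ballrV n (v w : 'rV[R]_n) (e : R) : 0 < e ->
  ball v e w <-> forall i, `|v ord0 i - w ord0 i| < e.
Proof.
move=> e0; split.
  by move=> [_ h] i; exact: h.
by move=> h; split => // i j; rewrite (ord1 i); exact: h.
Qed.

Lemma ocyl_cylinder n (U : set 'rV[R]_n) : open U -> ocyl n (cylinder U).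
Proof.
move=> oU; split; first exact: is_cyl_cylinder.
rewrite cylinderE => a [Ua ta].
have /nbhs_ballP[e /= e0 eU] : nbhs (vrow n a) U by exact: open_nbhs_nbhs.
exists e => // b tb ab; split => //; apply: eU; apply/ballrV => // i.
by rewrite !mxE ab.
Qed.

Lemma open_ocyl n S : ocyl n S -> open [set v | S (@vpad n v)].
Proof.
move=> [cS oS]; rewrite openE => v /= Sv.
have [e e0 eS] := oS _ Sv; apply/nbhs_ballP; exists e => //= w.
move=> /ballrV-/(_ e0) vw; apply: eS; first exact: tail_vpad.
by move=> i lin; rewrite !vpadE.
Qed.

Lemma lebesgue_rVE n (B : set 'rV[R]_n) : lebesgue_rV B = mu n (cylinder B).
Proof.
rewrite /mu cylinderE /lebesgue_rV; congr (lebesgue_tuple R n _).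
have e (t : Rtuple R n) : vrow n (pad t) = \row_i tnth t i.
  by apply/rowP => i; rewrite !mxE (tnth_nth 0).
by apply/seteqP; split => t /=; rewrite e; [split => //; exact: tail_pad|case].
Qed.

Lemma mcyl_borel n (B : set 'rV[R]_n) : borel_rV B -> mcyl n (cylinder B).
Proof.
move=> mB; pose W := [set A : set 'rV[R]_n | mcyl n (cylinder A)].
suff : W B by [].
apply: mB; split; last by move=> U /ocyl_cylinder /mcyl_ocyl.
split.
- rewrite /W /=; have -> : @cylinder R n set0 = set0 by apply/seteqP; split => a // -[].
  by apply: mcyl_kcyl; exact: kcyl0.
- move=> A WA; rewrite /W /= (_ : cylinder _ = tail n `\` cylinder A).
    by apply: mcylD => //; exact/mcyl_ocyl/ocyl_tail.
  rewrite !cylinderE; apply/seteqP; split => a [/= h1 h2].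
    by split => // -[h _]; exact: h1.2.
  by split => //; split => // Ah; apply: h2; split.
- move=> F WF; split; first exact: is_cyl_cylinder.
  rewrite (_ : cylinder _ = \bigcup_i cylinder (F i)).
    by rewrite preimage_bigcup; apply: bigcup_measurable => i _; exact: (WF i).2.
  rewrite cylinderE; apply/seteqP; split => a.
    by move=> [[i _ Fa] ta]; exists i => //; rewrite cylinderE.
  by move=> [i _]; rewrite cylinderE => -[Fa ta]; split => //; exists i.
Qed.

Lemma compact_kcyl n S : kcyl n S -> compact [set v | S (@vpad n v)].
Proof.
move=> [[cS fS] [c Sc]]; apply: bounded_closed_compact.
  exists (Num.max c 0); split; first by rewrite num_real.
  move=> d cd v /= Sv; apply: le_trans (ltW cd).
  rewrite [leLHS]/Num.Def.normr /= mx_normrE; apply/bigmax_leP; split => /=.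
    by rewrite le_max lexx orbT.
  move=> [i j] _ /=; rewrite (ord1 i) le_max; apply/orP; left.
  by have := Sc _ j Sv (ltn_ord j); rewrite vpadE; congr (`|v _ _| <= _); exact/val_inj.
move=> v clv /=; apply: fS; first exact: tail_vpad.
move=> e e0; have [w [Sw /ballrV-/(_ e0) vw]] := clv _ (nbhsx_ballx v e e0).
by exists (vpad w) => // i lin; rewrite distrC !vpadE.
Qed.

Lemma kcyl_cylinder n (K : set 'rV[R]_n) : compact K -> kcyl n (cylinder K).
Proof.
move=> cK; have clK : closed K by apply: compact_closed cK; exact: norm_hausdorff.
have cylK := is_cyl_cylinder K.
split; first split => //.
  rewrite cylinderE => l tl h; split => //; apply: clK => B /nbhs_ballP[e /= e0 eB].
  have [a [Ka ta] al] := h e e0; exists (vrow n a); split => //; apply: eB.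
  by apply/ballrV => // i; rewrite distrC !mxE al.
have [M [_ MK]] := compact_bounded cK.
exists (M + 1) => a i; rewrite cylinderE => -[Ka ta] lin.
have M1 : M < M + 1 by rewrite ltrDl.
have := MK _ M1 _ Ka.
move=> /(le_trans _); apply.
rewrite [leRHS]/Num.Def.normr /= mx_normrE; apply/bigmax_geP; right => /=.
by exists (ord0, Ordinal lin) => //=; rewrite mxE.
Qed.

Lemma borel_compact n (K : set 'rV[R]_n) : compact K -> borel_rV K.
Proof.
move=> cK; have clK : closed K by apply: compact_closed cK; exact: norm_hausdorff.
rewrite -(setCK K) -setTD; apply: sigma_algebraCD; apply: sub_sigma_algebra.
exact: closed_openC.
Qed.

Local Open Scope ereal_scope.

(** A set may be a cylinder in several dimensions, but [mu] gives the same value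
in all of them. *)
Lemma lambda_cylE n S : (0 < n)%N -> kcyl n S -> lambda_cyl S = mu n S.
Proof.
move=> n0 kS; rewrite /lambda_cyl.
set P := [set v | _].
have Pex : exists v, P v.
  exists (mu n S), n, [set v | S (@vpad n v)]; split => //.
  - by apply: borel_compact; exact: compact_kcyl.
  - by apply: cylinder_is_cyl; exact: kS.1.1.
  - by rewrite lebesgue_rVE -cylinder_is_cyl//; exact: kS.1.1.
have [m [B [m0 mB SB ->]]] : P (xget 0 P) := xgetPex 0 Pex.
rewrite lebesgue_rVE -SB; apply: mu_eq; last exact: mcyl_kcyl.
by rewrite SB; exact: mcyl_borel.
Qed.

Lemma Delta0P S : Delta0 S <-> exists n, [/\ (0 < n)%N, kcyl n S & 0 < mu n S].
Proof.
split=> [[n [K [n0 cK -> /andP[h _]]]]|[n [n0 kS h]]].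
  exists n; have kK := kcyl_cylinder cK; split => //.
  by rewrite -lambda_cylE.
exists n, [set v | S (@vpad n v)]; split => //.
- exact: compact_kcyl.
- by apply: cylinder_is_cyl; exact: kS.1.1.
- rewrite (lambda_cylE n0 kS) h mu_fin//; first exact: mcyl_kcyl.
  exact: kS.2.
Qed.

(** The induction hypothesis is used twice: on the first N sets, and on their
intersections with the last one, which shows that the overlap is null. *)
Lemma mu_bigcup_null m N (K : 'I_N -> set E) : (forall i, kcyl m (K i)) ->
  (forall i j, i != j -> mu m (K i `&` K j) = 0) ->
  kcyl m (\bigcup_i K i) /\ mu m (\bigcup_i K i) = \sum_(i < N) mu m (K i).
Proof.
elim: N K => [|N IH] K kK dis.
  have -> : \bigcup_i K i = set0 by apply/seteqP; split => // a [[]].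
  by rewrite big_ord0; split; [exact: kcyl0|rewrite /mu preimage_set0 measure0].
pose w := widen_ord (leqnSn N).
have [||kP muP] := IH (K \o w) => [i|i j ij|]; first exact: kK.
  by apply: dis; apply: contra ij => /eqP/(congr1 val)/= ?; exact/eqP/val_inj.
have -> : \bigcup_i K i = (\bigcup_i (K \o w) i) `|` K ord_max.
  apply/seteqP; split => a; last first.
    by move=> [[i _ Ka]|Ka]; [exists (w i)|exists ord_max].
  move=> [i _ Ka]; case: (unliftP ord_max i) Ka => [j|] -> Ka; last by right.
  by left; exists j => //=; congr (K _ a): Ka; apply/val_inj; exact: lift_max.
split; first exact: kcylU.
rewrite big_ord_recr /= -muP /mu preimage_setU.
have [_ mP] := mcyl_kcyl kP; have [_ mK] := mcyl_kcyl (kK ord_max).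
have [||_] := IH (fun i => K (w i) `&` K ord_max) => [i|i j ij|].
- by apply: kcylI => //; exact: (kK ord_max).1.
- apply/eqP; rewrite -measure_le0.
  have /= wij : w i != w j by apply: contra ij => /eqP/(congr1 val)/= ?; exact/eqP/val_inj.
  rewrite -(dis _ _ wij); apply: le_mu; last by move=> a [[? _] [? _]].
    by apply: mcylI; apply: mcylI; apply: mcyl_kcyl.
  by apply: mcylI; apply: mcyl_kcyl.
rewrite big1 => [|i _]; last first.
  apply: dis; rewrite -val_eqE /= neq_ltn ltn_ord; done.
rewrite -setI_bigcupl => null.
rewrite measureUfinl//; last by apply: mu_fin; [exact: mcyl_kcyl|exact: kP.2].
by rewrite -preimage_setI [X in _ - X](_ : _ = 0) ?sube0.
Qed.

(** In a dimension common to all the pieces, their union is again a cylinder with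
compact base. *)
Lemma Delta_kcyl (P : set E) v : Delta P v ->
  exists m, [/\ (0 < m)%N, kcyl m P & v = mu m P].
Proof.
move=> [N [K [DK dis -> ->]]].
have /choice[f hf] : forall i, exists n, (0 < n)%N /\ kcyl n (K i).
  by move=> i; have /Delta0P[n [? ? _]] := DK i; exists n.
pose M := (\max_i f i).+1.
have kK i : kcyl M (K i).
  by apply: kcylW (hf i).2; rewrite ltnW// ltnS leq_bigmax.
have [||kP muP] := @mu_bigcup_null M _ K => //.
  move=> i j ij; rewrite -lambda_cylE ?dis//.
  by apply: kcylI => //; exact: (kK j).1.
exists M; split => //; rewrite muP; apply: eq_bigr => i _.
exact: lambda_cylE.
Qed.

(** With [lambda_open_le], this says that the measure of an open set is the
supremum of the measures of its compact cylinders. *)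
Lemma le_lambda_open n S (G : set E) : (0 < n)%N -> kcyl n S -> S `<=` G ->
  mu n S <= lambda_open G.
Proof.
move=> n0 kS SG; apply: ereal_sup_ubound.
have [S0|S0] := leP (mu n S) 0.
  exists set0; last by [].
  exists 0%N, (fun=> set0); split; [by case|by case| |].
    by apply/seteqP; split => // a [[]].
  by rewrite big_ord0; apply/eqP; rewrite eq_le S0 /=; exact: measure_ge0.
exists S => //; exists 1%N, (fun=> S); split.
- by move=> _; apply/Delta0P; exists n.
- by move=> i j; rewrite !ord1.
- by apply/seteqP; split => a; [exists ord0|case].
- by rewrite big_ord1 (lambda_cylE n0).
Qed.

Lemma lambda_open_le (G : set E) (M : \bar R) :
  (forall n S, (0 < n)%N -> kcyl n S -> S `<=` G -> mu n S <= M) ->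
  lambda_open G <= M.
Proof.
move=> h; apply: ge_ereal_sup => _ [P /Delta_kcyl[m [m0 kP ->]] PG].
exact: h.
Qed.

End Link.

(** * The topology tau *)

Section Topology.
Context (R : realType).
Local Notation E := (Rinfty R).
Implicit Types (a b l x : E) (S G : set E) (n m k : nat).

Lemma X1P a : X1 a <-> exists2 n, (0 < n)%N & tail n a.
Proof.
rewrite /X1; split => [[n n0]|[n n0 ta]].
  by rewrite cylinderE => -[_ ta]; exists n.
by exists n => //; rewrite cylinderE.
Qed.

Lemma tail_X1 n a : tail n a -> X1 a.
Proof. by move=> ta; apply/X1P; exists n.+1 => //; apply: tailS ta. Qed.

Lemma cyl_X1 n S : is_cyl n S -> S `<=` @X1 R.
Proof. by move=> [ST _] a /ST /tail_X1. Qed.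

Lemma open_cyl n S : (0 < n)%N -> ocyl n S -> open S.
Proof.
move=> n0 oS; suff : tau S by []. split; last by apply: subIsetr.
rewrite setIidl; last exact: cyl_X1 oS.1.
apply: sub_gen_smallest; exists n, [set v | S (@vpad R n v)]; split => //.
  exact: open_ocyl.
by apply: cylinder_is_cyl; exact: oS.1.
Qed.

Lemma open_X2 (A : set E) : A `<=` @X2 R -> open A.
Proof.
move=> A2; suff : tau A by []. split; last by apply: subIsetr.
rewrite (_ : _ `&` _ = set0); last first.
  by apply/seteqP; split => // a [/A2].
have : open (set0 : set E) by exact: open0.
by case; rewrite set0I.
Qed.

(** n is the index of the piece of X1 that contains a: T_1, or T_n minus T_(n-1). *)
Definition minimal_tail n a :=
  [/\ (0 < n)%N, tail n a & forall m, (0 < m)%N -> tail m a -> (n <= m)%N].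

Lemma minimal_tailP a : X1 a -> exists n, minimal_tail n a.
Proof.
move=> /X1P[m m0 tm].
have ex : exists n, (0 < n)%N && `[< tail n a >].
  by exists m; rewrite m0; exact/asboolP.
exists (ex_minn ex); case: ex_minnP => n /andP[n0 /asboolP tn] h.
by split => // k k0 tk; apply: h; rewrite k0; exact/asboolP.
Qed.

Definition basic_nbhs n k (e : R) a : set E := [set b | tail n b /\ coord_close k e a b].

(** A subbasic cylinder around a has dimension at least n, by minimality, so near
a and within T_n it constrains finitely many coordinates to open sets; this
property passes to finite intersections and to unions. *)
Lemma open_basic_nbhs G a n : open G -> G a -> minimal_tail n a ->
  exists k, exists2 e : R, 0 < e & basic_nbhs n k e a `<=` G.
Proof.
case=> G1 _ Ga mta.
have X1a : X1 a by case: mta => _ /tail_X1.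
pose O' := [set O : set E | O `<=` @X1 R /\ forall a n, O a -> minimal_tail n a ->
  exists k, exists2 e : R, 0 < e & basic_nbhs n k e a `<=` O].
suff [_ /(_ a n (conj Ga X1a) mta)[k [e e0 h]]] : O' (G `&` @X1 R).
  by exists k, e => // b /h[].
apply: G1; split; last first.
  move=> C [m [U [m0 oU ->]]]; split.
    by apply: cyl_X1; exact: is_cyl_cylinder.
  move=> {mta}b {}n Ub mtb; have [cU oU'] := ocyl_cylinder oU.
  have [e e0 h] := oU' _ Ub; exists m, e => // c [tc bc]; apply: h => //.
  by apply: tailS tc; case: mtb => _ _; apply => //; exact: cU.1.
split.
- by move=> A [].
- split => // b m _ _; exists 0%N, 1 => // c [/tail_X1]; done.
- move=> A B [A1 hA] [_ hB]; split; first by move=> b [/A1].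
  move=> b m [Ab Bb] mtb.
  have [k [e e0 h]] := hA b m Ab mtb; have [k' [e' e'0 h']] := hB b m Bb mtb.
  exists (maxn k k'), (Num.min e e'); first by rewrite lt_min e0.
  move=> c [tc bc]; split.
    apply: h; split => // i ik; have := bc i (leq_trans ik (leq_maxl _ _)).
    by rewrite lt_min => /andP[].
  apply: h'; split => // i ik; have := bc i (leq_trans ik (leq_maxr _ _)).
  by rewrite lt_min => /andP[].
- move=> D hD; split; first by move=> b [A /hD[A1 _] /A1].
  move=> b m [A DA Ab] mtb; have [_ /(_ b m Ab mtb)[k [e e0 h]]] := hD _ DA.
  by exists k, e => // c /h Ac; exists A.
Qed.

Lemma open_coord (W : set R) i : open W -> open [set a : E | X1 a /\ W (a i)].
Proof.
move=> oW; rewrite (_ : mkset _ = \bigcup_n [set a | tail (n + i.+1)%N a /\ W (a i)]).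
  apply: bigcup_open => n _; apply: (@open_cyl (n + i.+1)); first by lia.
  split.
    split; first by move=> a [].
    by move=> a b [_ Wa] tb ab; split => //; rewrite -ab//; lia.
  move=> a [_ Wa]; have /nbhs_ballP[e /= e0 eW] : nbhs (a i) W by exact: open_nbhs_nbhs.
  exists e => // b tb ab; split => //; apply: eW; apply: ab; lia.
apply/seteqP; split => a.
  by move=> [/X1P[n _ ta] Wa]; exists n => //; split => //; apply: tailS ta; lia.
by move=> [n _ [/tail_X1 ? ?]].
Qed.

Lemma fmap_ultra (T U : Type) (f : T -> U) (F : set_system T) :
  UltraFilter F -> UltraFilter (f @ F).
Proof.
move=> FU; split; first exact: fmap_proper_filter.
move=> G GP FG; apply/seteqP; split=> [A GA|//].
have [//|FnA] := in_ultra_setVsetC (f @^-1` A) FU.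
have GnA : G (~` A) by exact: (FG (~` A) FnA).
by have [y []] := filter_ex (filterI GA GnA).
Qed.

(** No coordinate of index in ]0, n[ has its absolute value in the interval
]1/2, 1/2 + d[. The jump of tau in coordinate i comes from T_i being open,
which holds for i >= 1 only. *)
Definition gapped n (d : R) S := forall a i, S a -> (0 < i < n)%N ->
  `|a i| <= 2^-1 \/ 2^-1 + d <= `|a i|.

Lemma filter_close (F : set_system E) {FF : Filter F} l :
  (forall i (e : R), 0 < e -> F [set a | `|a i - l i| < e]) ->
  forall k e, 0 < e -> F [set a | coord_close k e a l].
Proof.
move=> Fl; elim=> [|k IH] e e0; first by apply: filterS filterT.
apply: filterS (filterI (IH e e0) (Fl k e e0)) => a [h1 h2] i.
by rewrite ltnS leq_eqVlt => /predU1P[->|/h1].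
Qed.

(** On a gapped subset of T_n, tau is the topology of coordinatewise convergence:
when l_i lies in I, the nearby values a_i are forced into I by the gap. *)
Lemma gapped_cvg (F : set_system E) {FF : ProperFilter F} S n (d : R) l :
  (0 < n)%N -> F S -> S `<=` tail n -> 0 < d -> gapped n d S ->
  (forall i (e : R), 0 < e -> F [set a | `|a i - l i| < e]) -> F --> l.
Proof.
move=> n0 FS ST d0 gS Fl.
have tl : tail n l.
  move=> i ni; apply/ler_addgt0Pr => e e0.
  have [a [Sa al]] := filter_ex (filterI FS (Fl i e e0)).
  have := ST _ Sa i ni; have -> : l i = a i - (a i - l i) by lra.
  by move=> ?; apply: le_trans (ler_normB _ _) _; move: al => /=; lra.
have [n1 mtl] := minimal_tailP (tail_X1 tl).
move=> B; rewrite /= nbhsE => -[G [oG Gl] GB].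
have [k [e e0 h]] := open_basic_nbhs oG Gl mtl.
have ed0 : 0 < Num.min e d by rewrite lt_min e0.
apply: filterS (filterI FS (filter_close Fl (maxn k n) ed0)) => a [Sa al].
apply/GB/h; split; last first.
  move=> i ik; have := al i (leq_trans ik (leq_maxl _ _)).
  by rewrite distrC lt_min => /andP[].
move=> i n1i; have [ni|lin] := leqP n i; first exact: ST Sa _ ni.
have [mt0 mt1 _] := mtl.
have i0n : (0 < i < n)%N by rewrite lin (leq_trans mt0).
have [//|dai] := gS a i Sa i0n.
have := al i (leq_trans lin (leq_maxr _ _)); rewrite lt_min => /andP[_].
have := mt1 i n1i => li ail; exfalso.
have : `|a i| <= `|a i - l i| + `|l i| by rewrite -{1}(subrK (l i) (a i)) ler_normD.
lra.
Qed.

(** Tychonoff's theorem for ultrafilters: the coordinates of an ultrafilter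
converge by compactness of segments, and [gapped_cvg] upgrades this to tau. *)
Lemma compact_gapped n S (d : R) : (0 < n)%N -> kcyl n S -> 0 < d ->
  gapped n d S -> compact S.
Proof.
move=> n0 kS d0 gS; rewrite compact_ultra => F FU FS.
have [[cS fS] [c Sc]] := kS.
have : forall i, exists r : R, forall e : R, 0 < e -> F [set a | `|a i - r| < e].
  move=> i; pose C := Num.max c 2^-1.
  have := @segment_compact R (- C) C; rewrite compact_ultra.
  have FiU : UltraFilter ((fun a : E => a i) @ F) by exact: fmap_ultra.
  move=> /(_ _ FiU) []; last first.
    move=> r [_ Fr]; exists r => e e0; apply: (Fr [set s | `|s - r| < e]).
    by apply/nbhs_ballP; exists e => // s; rewrite /ball /= distrC.
  suff : F ((fun a : E => a i) @^-1` `[- C, C]) by [].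
  apply: filterS FS => a Sa /=; rewrite in_itv /= -ler_norml le_max.
  have [lin|ni] := ltnP i n; first by rewrite (Sc a i Sa lin).
  by rewrite (cS.1 a Sa i ni) orbT.
move=> /choice[l Fl].
have Fl' : F --> (l : E) by apply: gapped_cvg n0 FS cS.1 d0 gS _.
exists l; split => //; apply: fS.
  move=> i ni; apply/ler_addgt0Pr => e e0.
  have [a [Sa al]] := filter_ex (filterI FS (Fl i e e0)).
  have := cS.1 _ Sa i ni; have -> : l i = a i - (a i - l i) by lra.
  by move=> ?; apply: le_trans (ler_normB _ _) _; move: al => /=; lra.
move=> e e0; have [a [Sa al]] := filter_ex (filterI FS (filter_close Fl n e0)).
by exists a.
Qed.

End Topology.

(** * Countable subadditivity *)

(** The characterization of compactness by finite subcovers is stated for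
pointed spaces. *)
HB.instance Definition _ (R : realType) := isPointed.Build (Rinfty R) (fun=> 0).

Section Subadditivity.
Context (R : realType).
Local Notation E := (Rinfty R).
Implicit Types (a b l x : E) (S G A B : set E) (n m k : nat).

Lemma mu_ge0 n S : (0 <= mu n S)%E. Proof. exact: measure_ge0. Qed.

Lemma mu_set0 n : mu n (set0 : set E) = 0%E.
Proof. by rewrite /mu preimage_set0 measure0. Qed.
Hint Resolve mu_ge0 : core.

Lemma mu_subU n S A B : mcyl n S -> mcyl n A -> mcyl n B -> S `<=` A `|` B ->
  (mu n S <= mu n A + mu n B)%E.
Proof.
move=> mS mA mB SAB; apply: le_trans (measureU2 _ mA.2 mB.2).
by rewrite -preimage_setU; apply: le_mu => //; exact: mcylU.
Qed.

Lemma muU n A B : mcyl n A -> mcyl n B -> A `&` B = set0 ->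
  mu n (A `|` B) = (mu n A + mu n B)%E.
Proof.
move=> mA mB AB0; rewrite /mu preimage_setU measureU//; [exact: mA.2|exact: mB.2|].
by rewrite -preimage_setI AB0 preimage_set0.
Qed.

(** Continuity from above; the bounded base of F 0 makes its measure finite. *)
Lemma mu_decr_ge n (F : nat -> set E) S (M : \bar R) :
  (forall k, mcyl n (F k)) -> mcyl n S -> bounded_cyl n (F 0%N) ->
  (forall k k', (k <= k')%N -> F k' `<=` F k) -> \bigcap_k F k = S ->
  (forall k, M <= mu n (F k))%E -> (M <= mu n S)%E.
Proof.
move=> mF mS bF dF FS MF.
have /cvg_lim <- // : mu n (F k) @[k --> \oo] --> mu n S.
  rewrite /mu -FS preimage_bigcap; apply: nonincreasing_cvg_mu.
  - by apply: mu_fin.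
  - by move=> k; exact: (mF k).2.
  - by rewrite -preimage_bigcap FS; exact: mS.2.
  - by move=> k k' kk'; apply/subsetPset => t; exact: dF.
apply: lime_ge; last by apply: nearW.
apply: ereal_nonincreasing_is_cvgn => k k' kk'; apply: le_mu => //; exact: dF.
Qed.

(** On the sequences a such that a - x lies in T_n, this keeps a - x away from the
jumps of tau. *)
Definition gapset n x (d : R) : set E := [set a | forall i, (0 < i < n)%N ->
  `|a i - x i| <= 2^-1 \/ 2^-1 + d <= `|a i - x i|].

Lemma gapsetS n x d d' : d <= d' -> gapset n x d' `<=` gapset n x d.
Proof. by move=> dd a ha i hi; case: (ha i hi) => h; [left|right; lra]. Qed.

Lemma gapset_ex n x a : exists k, gapset n x k.+1%:R^-1 a.
Proof.
elim: n => [|n [k IH]]; first by exists 0%N => i; lia.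
have [h|h] := leP `|a n - x n| 2^-1.
  exists k => i /andP[i0]; rewrite ltnS leq_eqVlt => /predU1P[->|lin]; first by left.
  by apply: IH; rewrite i0.
have h0 : 0 < `|a n - x n| - 2^-1 by rewrite subr_gt0.
have [k' _ /(_ k' (leqnn k'))/= hk'] := near_infty_natSinv_lt (PosNum h0).
have mono u v : (u <= v)%N -> v.+1%:R^-1 <= u.+1%:R^-1 :> R.
  by move=> uv; rewrite lef_pV2 ?posrE// ler_nat.
exists (maxn k k') => i /andP[i0]; rewrite ltnS leq_eqVlt => /predU1P[->|lin].
  right; have := mono _ _ (leq_maxr k k'); set u := _^-1; set v := (k'.+1%:R)^-1 in hk' *.
  by lra.
by apply: gapsetS (mono _ _ (leq_maxl k k')) _ IH _ _; rewrite i0.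
Qed.

Lemma fcyl_gapset n m x d : (n <= m)%N -> fcyl m (tail m `&` gapset n x d).
Proof.
move=> nm; split.
  split; first by move=> a [].
  move=> a b [ta ga] tb ab; split => // i /andP[i0 lin]; rewrite -ab; last lia.
  by apply: ga; rewrite i0.
move=> l tl hl; split => // i /andP[i0 lin].
have [|h1] := leP `|l i - x i| 2^-1; first by left.
have [|h2] := leP (2^-1 + d) `|l i - x i|; first by right.
exfalso; pose e := Num.min (`|l i - x i| - 2^-1) (2^-1 + d - `|l i - x i|).
have e0 : 0 < e by rewrite lt_min !subr_gt0 h1.
have [a [_ /(_ i) ga] /(_ i (leq_trans lin nm))] := hl e e0.
rewrite lt_min => /andP[al1 al2].
have := ler_distD (a i) (l i) (x i); have := ler_distD (l i) (a i) (x i).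
rewrite (distrC (l i) (a i)) => t1 t2.
by case: ga; [rewrite i0|lra|lra].
Qed.

(** The sets removed decrease to the empty set as d tends to 0, since only
finitely many coordinates are involved. *)
Lemma gap_small n m x S (e : R) : kcyl m S -> (n <= m)%N -> 0 < e ->
  exists2 d, 0 < d & (mu m (S `\` gapset n x d) <= e%:E)%E.
Proof.
move=> kS nm e0; apply: contrapT => h.
pose F k := S `\` gapset n x k.+1%:R^-1.
have FE k : F k = S `\` (tail m `&` gapset n x k.+1%:R^-1).
  apply/seteqP; split => a [Sa ga]; split => //; first by case.
  by move=> g; apply: ga; split => //; exact: kS.1.1.1.
have mF k : mcyl m (F k).
  by rewrite FE; apply: mcylD; [exact: mcyl_kcyl|exact/mcyl_fcyl/fcyl_gapset].
have : (e%:E <= mu m (set0 : set E))%E.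
  apply: (@mu_decr_ge m F) => //.
  - by apply: mcyl_kcyl; exact: kcyl0.
  - by have [c Sc] := kS.2; exists c => a i [Sa _]; exact: Sc.
  - move=> k k' kk' a [Sa ga]; split => // g; apply: ga; apply: gapsetS g.
    by rewrite lef_pV2 ?posrE// ler_nat.
  - apply/seteqP; split => // a Fa; have [k gk] := gapset_ex n x a.
    by have [_] := Fa k I; apply.
  - move=> k; rewrite leNgt; apply/negP => /ltW hk; apply: h.
    by exists k.+1%:R^-1 => //; rewrite invr_gt0.
by rewrite mu_set0 leNgt lte_fin e0.
Qed.

Lemma fcyl_tail n : fcyl n (tail n : set E).
Proof. by split; first exact: is_cyl_tail. Qed.

Lemma kcyl_closed_rat_box n k j q : (n <= k)%N -> kcyl k (closed_rat_box n k j q : set E).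
Proof.
move=> nk; have -> : (closed_rat_box n k j q : set E) = closed_rat_box k k j q `&` tail n.
  apply/seteqP; split => a.
    by move=> [ta ha]; split => //; split => //; apply: tailS ta.
  by move=> [[_ ha] ta]; split.
apply: kcylI; last exact/(fcylW nk)/fcyl_tail.
split; last first.
  exists (\sum_(i < k) (`|ratr (nth 0 q i)| + j.+1%:R^-1)) => a i [_ ha] lik.
  rewrite (bigD1 (Ordinal lik)) //= ler_wpDr//.
    by apply: sumr_ge0 => u _; rewrite addr_ge0// invr_ge0.
  rewrite -{1}(subrK (ratr (nth 0 q i)) (a i)) (le_trans (ler_normD _ _))//.
  by rewrite addrC lerD2l ha.
split.
  split; first by move=> a [].
  by move=> a b [ta ha] tb ab; split => // i ik; rewrite -ab// ha.
move=> l tl h; split => // i ik; apply/ler_addgt0Pr => e /h[a [_ /(_ i ik) ha] /(_ i ik) al].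
have -> : l i - ratr (nth 0 q i) = (a i - ratr (nth 0 q i)) - (a i - l i) by lra.
by apply: le_trans (ler_normB _ _) _; apply: lerD => //; exact: ltW.
Qed.

Lemma open_rat_box n k j q : (0 < n)%N -> open (rat_box n k j q : set E).
Proof.
move=> n0; elim: k => [|k IH].
  rewrite (_ : rat_box _ _ _ _ = tail n); last by apply/seteqP; split=> a // -[].
  exact/(open_cyl n0)/ocyl_tail.
rewrite (_ : rat_box _ _ _ _ = rat_box n k j q `&`
  [set a | X1 a /\ ball (ratr (nth 0 q k) : R) j.+1%:R^-1 (a k)]).
  by apply: openI => //; apply: open_coord; apply: ball_open; rewrite invr_gt0.
apply/seteqP; split => a.
  move=> [ta ha]; split; first by split => // i ik; apply: ha; exact: ltnW.
  by split; [exact: tail_X1 ta|rewrite /ball /= distrC ha].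
move=> [[ta ha] [_ hk]]; split => // i; rewrite ltnS leq_eqVlt => /predU1P[->|/ha//].
by rewrite distrC.
Qed.

Lemma open_rational G a : open G -> X1 a -> G a ->
  exists n d j q, [/\ (0 < n)%N, rat_box n (n + d) j q a & closed_rat_box n (n + d) j q `<=` G].
Proof.
move=> oG X1a Ga; have [n mta] := minimal_tailP X1a.
have [k [e e0 h]] := open_basic_nbhs oG Ga mta; have [n0 ta _] := mta.
have [j [q [h1 h2]]] := rational_approx a (n + k) e0.
exists n, k, j, q; split => //.
move=> b [tb hb]; apply: h; split => //.
by move=> i ik; apply: h2 => //; exact: leq_trans (leq_addl _ _).
Qed.

Local Open Scope ereal_scope.

Lemma lambda_open_ge0 G : 0 <= lambda_open G.
Proof.
by rewrite -(mu_set0 1); apply: le_lambda_open => //; exact: kcyl0.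
Qed.
Hint Resolve lambda_open_ge0 : core.

Lemma kcyl_bigsetU m (I : Type) (s : seq I) (P : pred I) (L : I -> set E) :
  (forall u, P u -> kcyl m (L u)) ->
  kcyl m (\big[setU/set0]_(u <- s | P u) L u).
Proof.
move=> kL; elim/big_ind : _ => //; [exact: kcyl0|move=> A B; exact: kcylU].
Qed.

(** (n, d, j, q) encodes the rational box of center q and radius 1 / (j + 1) in
the first n + d coordinates, within [tail n]. *)
Definition box_code := (nat * nat * nat * seq rat)%type.
Definition code_dim (u : box_code) := let: (n, d, j, q) := u in (n + d)%N.
Definition code_box (u : box_code) : set E :=
  let: (n, d, j, q) := u in rat_box n (n + d) j q.
Definition code_closed_box (u : box_code) : set E :=
  let: (n, d, j, q) := u in closed_rat_box n (n + d) j q.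
Definition code_pos (u : box_code) : bool :=
  let: (n, d, j, q) := u in (0 < n)%N.

Lemma kcyl_code_closed_box u : kcyl (code_dim u) (code_closed_box u).
Proof. by case: u => [[[n d] j] q]; apply: kcyl_closed_rat_box; exact: leq_addr. Qed.

Lemma code_box_closed u : code_box u `<=` code_closed_box u.
Proof. by case: u => [[[n d] j] q] a [ta h]; split => // i /h /ltW. Qed.

(** Here compactness for tau turns a countable cover by open sets into a finite
cover by compact cylinders of a common dimension M, where the inequality is the
finite subadditivity of Lebesgue measure. *)
Lemma mu_gapped_le n S (d : R) (G : nat -> set E) : (0 < n)%N -> kcyl n S ->
  (0 < d)%R -> gapped n d S -> (forall j, open (G j)) -> S `<=` \bigcup_j G j ->
  mu n S <= \sum_(j <oo) lambda_open (G j).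
Proof.
move=> n0 kS d0 gS oG SG.
have := compact_gapped n0 kS d0 gS; rewrite compact_cover.
move=> /(_ (nat * box_code)%type [set u | code_pos u.2 /\ code_closed_box u.2 `<=` G u.1]
  (fun u => code_box u.2)) [].
- by move=> [j [[[n' d'] j'] q]] /= [n'0 _]; exact: open_rat_box.
- move=> a Sa; have [j _ Ga] := SG a Sa.
  have [n' [d' [j' [q [h1 h2 h3]]]]] := open_rational (oG j) (cyl_X1 kS.1.1 Sa) Ga.
  by exists (j, (n', d', j', q)).
move=> D DG SD; pose s := finmap.enum_fset D.
pose M := (n + \max_(u <- s) code_dim u.2)%N.
have kL u : u \in s -> kcyl M (code_closed_box u.2).
  move=> us; apply: kcylW (kcyl_code_closed_box _); apply: leq_trans (leq_addl _ _).
  exact: leq_bigmax_seq.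
pose P j := \big[setU/set0]_(u <- s | (u \in s) && (u.1 == j)) code_closed_box u.2.
have kP j : kcyl M (P j) by apply: kcyl_bigsetU => u /andP[/kL].
have PG j : P j `<=` G j.
  rewrite /P -bigcup_seq_cond => a [u /= /andP[_ /andP[us /eqP <-]]].
  by have /set_mem[_] := DG u us; exact.
pose J := (\max_(u <- s) u.1).+1.
rewrite -(muW (leq_addr (\max_(u <- s) code_dim u.2) n)) -/M; last exact: mcyl_kcyl.
apply: le_trans (nneseries_lim_ge J _) => //.
rewrite big_mkord; apply: (@le_trans _ _ (\sum_(j < J) mu M (P j))).
  apply: (@content_subadditive _ _ _ (lebesgue_tuple R M) (@pad R M @^-1` S)
    (fun j => @pad R M @^-1` P j)).
  - by move=> j _; exact: (mcyl_kcyl (kP j)).2.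
  - by apply: (mcyl_kcyl (kcylW _ kS)).2; exact: leq_addr.
  move=> t St; have [u /= us ua] := SD _ St.
  suff : (\bigcup_(j in `I_J) (@pad R M @^-1` P j)) t by rewrite bigcup_mkord.
  exists u.1; first by rewrite /J /= ltnS; exact: leq_bigmax_seq.
  rewrite /= /P -bigcup_seq_cond; exists u; last exact: code_box_closed.
  by rewrite /= us eqxx.
apply: lee_sum => j _; apply: le_lambda_open => //.
by rewrite /M addn_gt0 n0.
Qed.

(** Removing small gaps from a compact cylinder makes it compact for tau, at an
arbitrarily small cost in measure. *)
Lemma lambda_open_bigcup (G : nat -> set E) : (forall j, open (G j)) ->
  lambda_open (\bigcup_j G j) <= \sum_(j <oo) lambda_open (G j).
Proof.
move=> oG; apply: lambda_open_le => n S n0 kS SG.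
apply/lee_addgt0Pr => e e0.
have [d d0 hd] := gap_small (fun=> 0%R) kS (leqnn n) e0.
have kS' : kcyl n (S `&` (tail n `&` gapset n (fun=> 0%R) d)).
  by apply: kcylI => //; exact: fcyl_gapset.
pose S' := S `&` (tail n `&` gapset n (fun=> 0%R) d).
apply: (@le_trans _ _ (mu n S' + mu n (S `\` gapset n (fun=> 0%R) d))).
  have -> : S `\` gapset n (fun=> 0%R) d = S `\` S'.
    apply/seteqP; split => a [Sa ga]; split => //; first by move=> [_ []].
    by move=> g; apply: ga; do 2!split => //; exact: kS.1.1.1.
  apply: mu_subU; try exact: mcyl_kcyl.
    by apply: mcylD; exact: mcyl_kcyl.
  by move=> a Sa; have [|] := pselect (S' a); [left|right].
apply: leeD => //; apply: (mu_gapped_le n0 kS' d0 _ oG); last by move=> a [/SG].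
by move=> a i [_ [_ g]] hi; have := g i hi; rewrite subr0.
Qed.

Lemma lambda_openS G G' : G `<=` G' -> lambda_open G <= lambda_open G'.
Proof.
move=> GG'; apply: lambda_open_le => n S n0 kS SG.
by apply: le_lambda_open kS _ => //; exact: subset_trans GG'.
Qed.

Lemma lambda_outer_open G : open G -> lambda_outer G <= lambda_open G.
Proof. by move=> oG; apply: ereal_inf_lbound; exists G => //; split. Qed.

Lemma le_lambda_outer (A B : set E) : A `<=` B -> lambda_outer A <= lambda_outer B.
Proof.
move=> AB; apply: le_ereal_inf => _ [G [oG BG] <-]; exists G => //; split => //.
exact: subset_trans BG.
Qed.

Lemma lambda_outer_ge0 (A : set E) : 0 <= lambda_outer A.
Proof. by apply: le_ereal_inf_tmp => _ [G _ <-]. Qed.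
Hint Resolve lambda_outer_ge0 : core.

Lemma lambda_outer_approx (A : set E) (e : R) : (0 < e)%R ->
  exists G, [/\ open G, A `<=` G & lambda_open G <= lambda_outer A + e%:E].
Proof.
move=> e0; have [Ay|Ay] := eqVneq (lambda_outer A) +oo.
  by exists setT; rewrite Ay addye// leey; split => //; exact: openT.
have Af : lambda_outer A \is a fin_num by rewrite ge0_fin_numE// ltey.
have [_ [G [oG AG] <-] h] := lb_ereal_inf_adherent e0 Af.
by exists G; split => //; exact: ltW.
Qed.

Lemma lambda_outer_bigcup (A : nat -> set E) :
  lambda_outer (\bigcup_j A j) <= \sum_(j <oo) lambda_outer (A j).
Proof.
apply/lee_addgt0Pr => e e0.
have e0' j : (0 < e / (2 ^ j.+1)%:R)%R by rewrite divr_gt0// ltr0n expn_gt0.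
have /choice[G hG] : forall j, exists G, [/\ open G, A j `<=` G &
    lambda_open G <= lambda_outer (A j) + (e / (2 ^ j.+1)%:R)%:E].
  by move=> j; exact: lambda_outer_approx.
apply: le_trans (epsilon_trick xpredT _ (ltW e0)) => //.
apply: (@le_trans _ _ (lambda_open (\bigcup_j G j))).
  apply: ereal_inf_lbound; exists (\bigcup_j G j) => //; split.
    by apply: bigcup_open => j _; have [] := hG j.
  by move=> a [j _ Aa]; exists j => //; have [_ h _] := hG j; exact: h.
apply: le_trans (lambda_open_bigcup _) _; first by move=> j; have [] := hG j.
by apply: lee_nneseries => // j _; have [] := hG j.
Qed.

Lemma lambda_outer_X2 (A : set E) : A `<=` @X2 R -> lambda_outer A = 0.
Proof.
move=> A2; apply/eqP; rewrite eq_le lambda_outer_ge0 andbT.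
apply: le_trans (lambda_outer_open (open_X2 A2)) _.
apply: lambda_open_le => n S n0 kS SA.
rewrite (_ : S = set0) ?mu_set0//; apply/seteqP; split => // a Sa.
exact: (A2 _ (SA _ Sa)) (cyl_X1 kS.1.1 Sa).
Qed.

Lemma lambda_outer0 : lambda_outer (set0 : set E) = 0.
Proof. exact: lambda_outer_X2. Qed.

Lemma lambda_outerU (A B : set E) :
  lambda_outer (A `|` B) <= lambda_outer A + lambda_outer B.
Proof.
rewrite -bigcup2E; apply: le_trans (lambda_outer_bigcup _) _.
rewrite (nneseries_split 0 2)// add0n eseries0 ?adde0.
  by rewrite big_nat_recr// big_nat1.
by move=> [|[|i]]// _ _; rewrite /bigcup2 /= lambda_outer0.
Qed.

Lemma lambda_open_mcyl n G : mcyl n G -> lambda_open G <= mu n G.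
Proof.
move=> mG; apply: lambda_open_le => m S m0 kS SG.
rewrite -(muW (leq_maxl n m) mG) -(muW (leq_maxr n m) (mcyl_kcyl kS)).
by apply: le_mu SG; [apply: mcylW (mcyl_kcyl kS); exact: leq_maxr|
  apply: mcylW mG; exact: leq_maxl].
Qed.

Lemma coord_close_slack k (e : R) a b : coord_close k e a b ->
  exists2 d : R, (0 < d)%R & forall c, coord_close k d b c -> coord_close k e a c.
Proof.
elim: k => [|k IH] h; first by exists 1%R.
have [|d d0 hd] := IH; first by move=> i ik; apply: h; exact: ltnW.
have hk := h k (ltnSn k).
exists (Num.min d (e - `|a k - b k|)%R); first by rewrite lt_min d0 subr_gt0.
move=> c bc i; rewrite ltnS leq_eqVlt => /predU1P[->|ik].
  have := bc k (ltnSn k); rewrite lt_min => /andP[_].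
  by have := ler_distD (b k) (a k) (c k); lra.
apply: hd => // i' i'k; have := bc i' (ltnW i'k).
by rewrite lt_min => /andP[].
Qed.

(** Outer regularity: the open thickenings of L of radius 1 / (k + 1), minus L',
are open cylinders decreasing to L minus L', because the base of L is closed.
Differences of compact cylinders suffice to cut an open set into disjoint
pieces. *)
Lemma lambda_outer_diff n (L L' : set E) : (0 < n)%N -> kcyl n L -> fcyl n L' ->
  lambda_outer (L `\` L') <= mu n (L `\` L').
Proof.
move=> n0 kL fL'.
pose U k : set E := [set b | tail n b /\ exists2 a, L a & coord_close n k.+1%:R^-1 a b].
have oU k : ocyl n (U k).
  split.
    split; first by move=> b [].
    move=> b c [tb [a La ab]] tc bc; split => //; exists a => // i lin.
    by rewrite -bc// ab.
  move=> b [tb [a La ab]]; have [d d0 hd] := coord_close_slack ab.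
  by exists d => // c tc bc; split => //; exists a => //; exact: hd.
have oD k : ocyl n (U k `\` L') by exact: ocylD.
apply: (@mu_decr_ge n (fun k => U k `\` L')).
- by move=> k; exact: mcyl_ocyl.
- by apply: mcylD; [exact: mcyl_kcyl|exact: mcyl_fcyl].
- have [c Lc] := kL.2; exists (c + 1)%R => b i [[_ [a La ab]] _] lin.
  have := ab i lin; rewrite invr1 => abi.
  have := Lc a i La lin; have -> : b i = (a i - (a i - b i))%R by lra.
  by move=> ?; apply: le_trans (ler_normB _ _) _; lra.
- move=> k k' kk' b [[tb [a La ab]] L'b]; split => //; split => //; exists a => // i lin.
  by apply: lt_le_trans (ab i lin) _; rewrite lef_pV2 ?posrE// ler_nat.
- apply/seteqP; split => b.
    move=> Ub; have [[tb _] L'b] := Ub 0%N I; split => //.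
    apply: kL.1.2 => // e e0.
    have [k _ /(_ k (leqnn k))/= ke] := near_infty_natSinv_lt (PosNum e0).
    have [[_ [a La ab]] _] := Ub k I; exists a => // i lin.
    exact: lt_trans (ab i lin) ke.
  move=> [Lb L'b] k _; split => //; split; first exact: kL.1.1.1.
  by exists b => // i _; rewrite subrr normr0 invr_gt0.
- move=> k; apply: le_trans (lambda_open_mcyl (mcyl_ocyl (oD k))).
  apply: ereal_inf_lbound; exists (U k `\` L') => //; split; first exact: open_cyl (oD k).
  move=> b [Lb L'b]; split => //; split; first exact: kL.1.1.1.
  by exists b => // i _; rewrite subrr normr0 invr_gt0.
Qed.

End Subadditivity.

(** * Translates of cylinders *)

Section Translation.
Context (R : realType).
Local Notation E := (Rinfty R).
Local Notation leb := (@lebesgue_measure R).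
Implicit Types (a b l x : E) (S G A B C : set E) (n m k : nat).
Hint Resolve mu_ge0 lambda_outer_ge0 lambda_open_ge0 : core.

(** A - x, written as a preimage. *)
Definition preshift x A : set E := [set b | A (addE b x)].

Lemma translate_subE A x : translate_sub A x = preshift x A.
Proof.
apply/seteqP; split => b.
  move=> [a Aa <-]; rewrite /preshift /=; congr A: Aa.
  by apply/funext => i; rewrite /addE subrK.
by move=> Ab; exists (addE b x) => //; apply/funext => i; rewrite /addE addrK.
Qed.

Local Open Scope ereal_scope.

(** What I + y does not cover of I lies in a half-open interval of length |y|. *)
Lemma leb_Iset_shift (y : R) :
  leb (@Iset R `\` [set r | @Iset R (r - y)%R]) <= `|y|%:E.
Proof.
have [y0|y0] := leP 0%R y.
  apply: (@le_trans _ _ (leb `[(- 2^-1)%R, (- 2^-1 + y)%R[%classic)).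
    apply: le_measure; rewrite ?inE//.
      apply: measurableD; first exact: measurable_Iset.
      rewrite (_ : mkset _ = `[(y - 2^-1)%R, (y + 2^-1)%R]%classic)//.
      by apply/seteqP; split => r; rewrite /Iset /= !in_itv /=; lra.
    by move=> r; rewrite /Iset /= !in_itv /= => -[/andP[h1 h2]] /negP; lra.
  rewrite lebesgue_measure_itv /= lte_fin; case: ifP => _.
    by rewrite -EFinB lee_fin ger0_norm//; lra.
  by rewrite lee_fin.
apply: (@le_trans _ _ (leb `](2^-1 + y)%R, (2^-1)%R]%classic)).
  apply: le_measure; rewrite ?inE//.
    apply: measurableD; first exact: measurable_Iset.
    rewrite (_ : mkset _ = `[(y - 2^-1)%R, (y + 2^-1)%R]%classic)//.
    by apply/seteqP; split => r; rewrite /Iset /= !in_itv /=; lra.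
  by move=> r; rewrite /Iset /= !in_itv /= => -[/andP[h1 h2]] /negP; lra.
rewrite lebesgue_measure_itv /= lte_fin; case: ifP => _.
  by rewrite -EFinB lee_fin ltr0_norm//; lra.
by rewrite lee_fin.
Qed.

Lemma measurable_Iset_shift (y : R) :
  measurable ([set r | @Iset R (r - y)%R] : set (measurableTypeR R)).
Proof.
rewrite (_ : mkset _ = `[(y - 2^-1)%R, (y + 2^-1)%R]%classic)//.
by apply/seteqP; split => r; rewrite /Iset /= !in_itv /=; lra.
Qed.

Definition slab S i (y : R) : set E := S `&` [set a | ~ @Iset R (a i - y)%R].

Lemma mu_slab n S i y : mcyl n S -> (n <= i)%N ->
  mcyl i.+1 (slab S i y) /\ mu i.+1 (slab S i y) <= mu n S * `|y|%:E.
Proof.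
move=> mS ni; have mS' := mcylW ni mS.
pose J : set (measurableTypeR R) := @Iset R `\` [set r | @Iset R (r - y)%R].
have mJ : measurable J.
  by apply: measurableD; [exact: measurable_Iset|exact: measurable_Iset_shift].
have -> : slab S i y = cyl_prod i S J.
  rewrite (cyl_prodE mS'.1); last by move=> r [].
  apply/seteqP; split => a [Sa]; last by move=> [_ ?]; split.
  by move=> h; split => //; split => //; apply/IsetE; exact: mS'.1.1.
split; first exact: mcyl_prod.
rewrite mu_prod// (muW ni mS) lee_wpmul2l//.
exact: leb_Iset_shift.
Qed.

Lemma ell1_tail x n (e : R) : ell1 R x -> (0 < e)%R ->
  exists2 m, (n <= m)%N & \sum_(m <= i <oo) `|x i|%:E <= e%:E.
Proof.
move=> lx e0; have x0 k : xpredT k -> 0 <= `|x k|%:E by rewrite lee_fin.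
have cvg0 := @nneseries_tail_cvg R (fun i => `|x i|%:E) xpredT lx x0.
apply: contrapT => h.
suff : e%:E <= 0 by rewrite lee_fin leNgt e0.
have /cvg_lim <- // := cvg0; apply: lime_ge; first by apply/cvg_ex; exists 0.
exists n => // m nm; rewrite /= leNgt; apply/negP => /ltW hm; apply: h.
by exists m.
Qed.

(** The common shape of the estimates below: A is covered by a main part B and, for
each coordinate i >= m, by an exceptional set of measure O(|x_i|). *)
Lemma lambda_outer_tail A B (F : nat -> set E) m (V : R) x : (0 <= V)%R ->
  A `<=` @X2 R `|` (B `|` \bigcup_(i in [set i | (m <= i)%N]) F i) ->
  (forall i, (m <= i)%N -> lambda_outer (F i) <= V%:E * `|x i|%:E) ->
  lambda_outer A <= lambda_outer B + V%:E * \sum_(m <= i <oo) `|x i|%:E.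
Proof.
move=> V0 AB hF; apply: le_trans (le_lambda_outer AB) _.
apply: le_trans (lambda_outerU _ _) _; rewrite (lambda_outer_X2 (@subset_refl _ _)) add0e.
apply: le_trans (lambda_outerU _ _) _; apply: leeD => //.
rewrite bigcup_mkcond; apply: le_trans (lambda_outer_bigcup _) _.
rewrite -nneseriesZl//.
rewrite [leRHS]eseries_cond [leRHS]eseries_mkcond; apply: lee_nneseries => // i _.
case: ifPn => [/set_mem /= mi|mi]; first by rewrite mi; exact: hF.
by rewrite ifF ?lambda_outer0//; apply/negbTE; apply: contra mi => mi; exact/mem_set.
Qed.

(** The main part is [shift_cyl m x C]; the exceptional set [F i] consists of the
points b for which i is the last coordinate outside I. Translating [F i] back
in its first i + 1 coordinates gives a [slab] of C, whence its measure. *)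
Lemma lambda_outer_preshift_diff n L L' x : (0 < n)%N -> kcyl n L -> kcyl n L' ->
  ell1 R x ->
  lambda_outer (preshift x (L `\` L')) <= mu n (L `\` L').
Proof.
move=> n0 kL kL' lx; set C := L `\` L'.
have mC : mcyl n C by apply: mcylD; exact: mcyl_kcyl.
have Vfin : mu n C \is a fin_num.
  rewrite ge0_fin_numE//; apply: mu_fin => //.
  by have [c Lc] := kL.2; exists c => a i [La _]; exact: Lc.
pose F i := shift_cyl i.+1 x C `\` tail i.
have EC m : shift_cyl m x C = shift_cyl m x L `\` shift_cyl m x L'.
  apply/seteqP; split => b; first by move=> [tb [? h]]; split => // -[].
  by move=> [[tb Lb] h]; split => //; split => // h'; apply: h.
have hE m : (n <= m)%N -> lambda_outer (shift_cyl m x C) <= mu n C.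
  move=> nm; rewrite -(muW nm mC) -(mu_shift x (mcylW nm mC)) EC.
  apply: lambda_outer_diff; first exact: leq_trans nm.
    exact/kcyl_shift/(kcylW nm).
  exact/fcyl_shift/(fcylW nm)/kL'.1.
have hF i : (n <= i)%N -> lambda_outer (F i) <= mu n C * `|x i|%:E.
  move=> ni; have ni1 : (n <= i.+1)%N by exact: leqW.
  have FE : F i = shift_cyl i.+1 x (slab C i (x i)).
    apply/seteqP; split => b.
      move=> [[tb Cb] ntb]; split => //; split => // h; apply: ntb => j.
      rewrite leq_eqVlt => /predU1P[<-|]; last exact: tb.
      by move: h; rewrite /= /trunc ltnSn /addE addrK => /IsetE.
    move=> [tb [Cb h]]; split => // h'; apply: h.
    by rewrite /= /trunc ltnSn /addE addrK; apply/IsetE/h'.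
  have [mF le_F] := mu_slab (x i) mC ni.
  apply: le_trans le_F; rewrite -(mu_shift x mF) -FE.
  (* outer regularity applies to [F i] only as a difference of compact cylinders *)
  have FE2 : F i = shift_cyl i.+1 x L `\`
      (shift_cyl i.+1 x L' `|` tail i).
    rewrite /F EC; apply/seteqP; split => b.
      by move=> [[h1 h2] h3]; split => // -[].
    move=> [h1 /not_orP[h2 h3]]; by split.
  rewrite FE2; apply: lambda_outer_diff => //; first exact/kcyl_shift/(kcylW ni1).
  apply: fcylU; first exact/fcyl_shift/(fcylW ni1)/kL'.1.
  exact: fcylW (fcyl_tail _ _).
have cover m : (n <= m)%N -> preshift x C `<=`
    @X2 R `|` (shift_cyl m x C `|` \bigcup_(i in [set i | (m <= i)%N]) F i).
  move=> nm b Cb; have [X1b|] := pselect (X1 b); last by left.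
  right; have Ctr p : (n <= p)%N -> C (trunc p (addE b x)).
    move=> np; apply: (mC.1.2 _ _ Cb).
      by apply: tail_trunc => //; exact: mC.1.1.
    by move=> i lin; rewrite /trunc (leq_trans lin np).
  have [p [p0 tp minp]] := minimal_tailP X1b.
  have [pm|mp] := leqP p m.
    by left; split; [exact: tailS tp|exact: Ctr].
  right; exists p.-1; first by rewrite /= -ltnS prednK.
  rewrite /F prednK//; split.
    by split => //; apply: Ctr; exact: ltnW (leq_ltn_trans nm mp).
  move=> /minp; rewrite -ltnS prednK//; lia.
apply/lee_addgt0Pr => e e0.
pose V := fine (mu n C).
have V0 : (0 <= V)%R by rewrite fine_ge0.
(* V + 1 rather than V, which may be zero *)
have e0' : (0 < e / (V + 1))%R by rewrite divr_gt0//; lra.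
have [m nm hm] := ell1_tail n lx e0'.
apply: le_trans (lambda_outer_tail V0 (cover m nm) _) _.
  by move=> i mi; rewrite fineK//; apply: hF; exact: leq_trans mi.
apply: leeD; first exact: hE.
apply: le_trans (lee_wpmul2l _ hm) _ => //.
rewrite -EFinM lee_fin mulrA ler_pdivrMr; last lra.
by rewrite mulrC ler_wpM2l; lra.
Qed.

End Translation.

(** * The outer measure under summable translations *)

Section OuterInvariance.
Context (R : realType).
Local Notation E := (Rinfty R).
Implicit Types (a b l x : E) (S G A B C : set E) (n m k : nat).
Local Open Scope ereal_scope.
Hint Extern 0 (is_true (0 <= mu _ _)) => solve [apply: mu_ge0] : core.
Hint Extern 0 (is_true (0 <= lambda_outer _)) => solve [apply: lambda_outer_ge0] : core.
Hint Extern 0 (is_true (0 <= lambda_open _)) => solve [apply: lambda_open_ge0] : core.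

(** Dimension and size grow together, so that these boxes exhaust X1; they
increase because the size is at least 1, hence larger than 1/2. *)
Definition open_box k : set E :=
  [set b | tail k.+1 b /\ coord_close k.+1 k.+1%:R (fun=> 0%R) b].

Lemma ocyl_open_box k : ocyl k.+1 (open_box k).
Proof.
split.
  split; first by move=> a [].
  by move=> a b [_ ha] tb ab; split => // i ik; rewrite -ab// ha.
move=> a [ta /coord_close_slack[d d0 hd]]; exists d => // b tb /hd; by split.
Qed.

Lemma open_box_box k : open_box k `<=` box k.+1 k.+1%:R.
Proof.
by move=> a [ta ha]; split => // i /ha; rewrite sub0r normrN => /ltW.
Qed.

Lemma open_boxS k k' : (k <= k')%N -> open_box k `<=` open_box k'.
Proof.
move=> kk' a [ta ha]; split; first exact: tailS ta.
move=> i ik'; have [ik|ki] := ltnP i k.+1.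
  by apply: lt_le_trans (ha i ik) _; rewrite ler_nat.
rewrite sub0r normrN; apply: le_lt_trans (ta i ki) _.
have : (1 <= k'.+1%:R :> R)%R by rewrite ler1n.
lra.
Qed.

Lemma X1_open_box a : X1 a -> exists k, open_box k a.
Proof.
move=> /X1P[n n0 ta].
have [k hk] : exists k, forall i, (i < n)%N -> (`|a i| < k.+1%:R)%R.
  elim: n {n0 ta} => [|n [k IH]]; first by exists 0%N.
  exists (maxn k (Num.truncn `|a n|)) => i.
  rewrite ltnS leq_eqVlt => /predU1P[->|/IH h].
    by apply: lt_le_trans (truncnS_gt _) _; rewrite ler_nat ltnS leq_maxr.
  by apply: lt_le_trans h _; rewrite ler_nat ltnS leq_maxl.
exists (maxn k n); split; first by apply: tailS ta; rewrite ltnW// ltnS leq_maxr.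
move=> i _; rewrite sub0r normrN; have [lin|ni] := ltnP i n.
  by apply: lt_le_trans (hk i lin) _; rewrite ler_nat ltnS leq_maxl.
apply: le_lt_trans (ta i ni) _.
have : (1 <= (maxn k n).+1%:R :> R)%R by rewrite ler1n.
lra.
Qed.

Lemma fcyl_Iset_shift i (y : R) :
  fcyl i.+1 (tail i.+1 `&` [set a : E | Iset (a i - y)%R]).
Proof.
split.
  split; first by move=> a [].
  by move=> a b [ta ha] tb ab; split => //=; rewrite -ab.
move=> l tl hl; split => //; apply/IsetE; apply/ler_addgt0Pr => e /hl.
move=> [a [_ /IsetE ha] /(_ i (ltnSn i)) al].
have -> : (l i - y = (a i - y) - (a i - l i))%R by lra.
by apply: le_trans (ler_normB _ _) _; apply: lerD => //; exact: ltW.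
Qed.

Lemma lambda_outer_slab n S i (y : R) : (0 < n)%N -> kcyl n S -> (n <= i)%N ->
  lambda_outer (slab S i y) <= mu n S * `|y|%:E.
Proof.
move=> n0 kS ni; have [_ h] := mu_slab y (mcyl_kcyl kS) ni.
apply: le_trans h.
have ni1 := leqW ni.
have -> : slab S i y = S `\` (tail i.+1 `&` [set a | Iset (a i - y)%R]).
  apply/seteqP; split => a [Sa h]; split => //; first by move=> [_]; exact: h.
  move=> h'; apply: h; split => //.
  by apply: (tailS ni1); exact: kS.1.1.1.
exact: lambda_outer_diff (kcylW ni1 kS) (fcyl_Iset_shift i y).
Qed.

Lemma lambda_outer_tail_eq0 A n (V : R) x (F : nat -> set E) : ell1 R x -> (0 <= V)%R ->
  (forall m, (n <= m)%N -> A `<=` @X2 R `|` \bigcup_(i in [set i | (m <= i)%N]) F i) ->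
  (forall i, (n <= i)%N -> lambda_outer (F i) <= V%:E * `|x i|%:E) ->
  lambda_outer A = 0.
Proof.
move=> lx V0 cover hF; apply/eqP; rewrite eq_le lambda_outer_ge0 andbT.
apply/lee_addgt0Pr => e e0.
have e0' : (0 < e / (V + 1))%R by rewrite divr_gt0//; lra.
have [m nm hm] := ell1_tail n lx e0'.
apply: le_trans (@lambda_outer_tail _ A set0 F m V x V0 _ _) _.
- by rewrite set0U; exact: cover.
- by move=> i mi; apply: hF; exact: leq_trans mi.
rewrite lambda_outer0 !add0e; apply: le_trans (lee_wpmul2l _ hm) _ => //.
rewrite -EFinM lee_fin mulrA ler_pdivrMr; last lra.
by rewrite mulrC ler_wpM2l; lra.
Qed.

(** If b lies in X1 but b + x does not, then b_i + x_i leaves I for arbitrarily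
large i; on a bounded box this happens in coordinate i on a set of measure
O(|x_i|). *)
Lemma lambda_outer_preshift_X2 x : ell1 R x -> lambda_outer (preshift x (@X2 R)) = 0.
Proof.
move=> lx; apply/eqP; rewrite eq_le lambda_outer_ge0 andbT.
have cover : preshift x (@X2 R) `<=` @X2 R `|` \bigcup_k (box k.+1 k.+1%:R `&` preshift x (@X2 R)).
  move=> b hb; have [X1b|] := pselect (X1 b); last by left.
  by have [k /open_box_box hk] := X1_open_box X1b; right; exists k.
apply: le_trans (le_lambda_outer cover) _; apply: le_trans (lambda_outerU _ _) _.
rewrite (lambda_outer_X2 (@subset_refl _ _)) add0e.
apply: le_trans (lambda_outer_bigcup _) _; rewrite eseries0// => k _ _.
have kB := kcyl_box k.+1 (k.+1%:R : R).
have Bfin : mu k.+1 (box k.+1 (k.+1%:R : R)) \is a fin_num.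
  by rewrite ge0_fin_numE// mu_box_fin.
apply: (@lambda_outer_tail_eq0 _ k.+1 (fine (mu k.+1 (box k.+1 (k.+1%:R : R)))) x
  (fun i => slab (box k.+1 k.+1%:R) i (- x i)%R)) => //.
- by rewrite fine_ge0.
- move=> m km b [Bb X2b]; right; apply: contrapT => h; apply: X2b.
  apply: (@tail_X1 _ m) => i mi; apply/IsetE; apply: contrapT => hi; apply: h.
  by exists i => //; split => //; rewrite /= opprK.
- move=> i ki; rewrite fineK// -[X in _ * X%:E]normrN.
  exact: lambda_outer_slab.
Qed.

(** G is, up to X2, the union of countably many rational closed boxes [D u]
(empty when u encodes no box inside G); [C u] is what [D u] adds to the union
[L u] of the previous ones, so that the measures of the [C u] add up to at most
that of G. *)
Lemma lambda_outer_preshift_open x G : ell1 R x -> open G ->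
  lambda_outer (preshift x G) <= lambda_open G.
Proof.
move=> lx oG.
pose good (v : box_code) := code_pos v /\ @code_closed_box R v `<=` G.
have /choice[Df hDf] : forall u : nat, exists Df : set E * nat,
    [/\ (0 < Df.2)%N, kcyl Df.2 Df.1, Df.1 `<=` G &
      forall v, unpickle u = Some v -> good v -> Df.1 = @code_closed_box R v].
  move=> u; case: (unpickle u) => [v|]; last first.
    by exists (set0, 1%N); split => //; exact: kcyl0.
  have [gv|gv] := pselect (good v); last first.
    exists (set0, 1%N); split => //; first exact: kcyl0.
    by move=> v' [<-].
  exists (@code_closed_box R v, code_dim v); split => //=.
  - by case: v gv => [[[n d] j] q] [/= n0 _]; rewrite addn_gt0 n0.
  - exact: kcyl_code_closed_box.
  - exact: gv.2.
  - by move=> v' [<-].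
pose D u := (Df u).1; pose f u := (Df u).2.
(* a dimension in which [D u] is a cylinder for every u < N *)
pose M N := (\sum_(u < N) f u).+1.
pose L N := \big[setU/set0]_(u < N) D u.
have MS N : (M N <= M N.+1)%N by rewrite /M big_ord_recr /= ltnS leq_addr.
have kD N : kcyl (M N.+1) (D N).
  have [_ kD _ _] := hDf N; apply: kcylW kD.
  by rewrite /M big_ord_recr /= ltnW// ltnS leq_addl.
have kL N : kcyl (M N) (L N).
  elim: N => [|N IH]; first by rewrite /L big_ord0; exact: kcyl0.
  by rewrite /L big_ord_recr /=; apply: kcylU => //; exact: kcylW IH.
pose C N := D N `\` L N.
have mC N : mcyl (M N.+1) (C N).
  by apply: mcylD; apply: mcyl_kcyl => //; exact: kcylW (kL N).
have outC N : lambda_outer (preshift x (C N)) <= mu (M N.+1) (C N).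
  by apply: lambda_outer_preshift_diff => //; exact: kcylW (kL N).
have sumC N : \sum_(0 <= u < N) mu (M u.+1) (C u) = mu (M N) (L N).
  elim: N => [|N IH]; first by rewrite big_geq// /L big_ord0 mu_set0.
  rewrite big_nat_recr//= IH -(muW (MS N) (mcyl_kcyl (kL N))) -muU//.
  - rewrite /L big_ord_recr /= -/(L N) /C setUDr setDv setD0; done.
  - exact/mcyl_kcyl/(kcylW (MS N)).
  - by apply/seteqP; split => // a [La [_ ]].
have LG N : L N `<=` G.
  rewrite /L -bigcup_mkord => a [u _]; have [_ _ + _] := hDf u; exact.
have cover : preshift x G `<=` preshift x (@X2 R) `|` \bigcup_N preshift x (C N).
  move=> b Gb; have [X1b|] := pselect (X1 (addE b x)); last by left.
  right; have [n [d [j [q [n0 h1 h2]]]]] := open_rational oG X1b Gb.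
  have ex : exists u, `[< D u (addE b x) >].
    exists (pickle (n, d, j, q)); apply/asboolP.
    have [_ _ _ /(_ (n, d, j, q))] := hDf (pickle (n, d, j, q)).
    rewrite pickleK /D => -> //; exact: (@code_box_closed R (n, d, j, q)).
  case: (ex_minnP ex) => N /asboolP DN minN; exists N => //; split => //.
  rewrite /L -bigcup_mkord => -[u /= uN Du].
  have /minN : `[< D u (addE b x) >] by exact/asboolP.
  by rewrite leqNgt uN.
apply: le_trans (le_lambda_outer cover) _; apply: le_trans (lambda_outerU _ _) _.
rewrite lambda_outer_preshift_X2// add0e; apply: le_trans (lambda_outer_bigcup _) _.
apply: (@le_trans _ _ (\sum_(N <oo) mu (M N.+1) (C N))).
  by apply: lee_nneseries => [N _ _|N _]; [exact: lambda_outer_ge0|exact: outC].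
apply: lime_le; first exact: is_cvg_nneseries.
by apply: nearW => N; rewrite sumC; exact: le_lambda_open (kL N) (LG N).
Qed.

Lemma lambda_outer_preshift_le x A : ell1 R x ->
  lambda_outer (preshift x A) <= lambda_outer A.
Proof.
move=> lx; apply: le_ereal_inf_tmp => _ [G [oG AG] <-].
apply: le_trans (lambda_outer_preshift_open lx oG).
by apply: le_lambda_outer => b; exact: AG.
Qed.

Definition oppE x : E := fun i => (- x i)%R.

Lemma ell1_oppE x : ell1 R x -> ell1 R (oppE x).
Proof.
rewrite /ell1 /=; congr (_ < _); congr (limn _); apply/funext => n.
by apply: eq_bigr => i _; rewrite /oppE normrN.
Qed.

Lemma preshift_oppE x A : preshift (oppE x) (preshift x A) = A.
Proof.
rewrite /preshift; apply/funext => a /=; congr A; apply/funext => i.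
by rewrite /addE /oppE subrK.
Qed.

Lemma oppEK x : oppE (oppE x) = x.
Proof. by apply/funext => i; rewrite /oppE opprK. Qed.

Lemma lambda_outer_preshift x A : ell1 R x ->
  lambda_outer (preshift x A) = lambda_outer A.
Proof.
move=> lx; apply/eqP; rewrite eq_le lambda_outer_preshift_le//=.
rewrite -{1}(preshift_oppE x A); apply: lambda_outer_preshift_le; exact: ell1_oppE.
Qed.

End OuterInvariance.

(** * The inner measure under summable translations *)

Section InnerInvariance.
Context (R : realType).
Local Notation E := (Rinfty R).
Implicit Types (a b l x : E) (S G A B C F M : set E) (n m k : nat).

Lemma compact_sub_open_box F : compact F -> exists k, F `<=` @X2 R `|` @open_box R k.
Proof.
rewrite compact_cover => /(_ nat setT (fun k => @X2 R `|` @open_box R k)) [].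
- move=> k _; apply: openU; first exact: open_X2.
  by apply: open_cyl (@ocyl_open_box R k).
- move=> a _; have [X1a|X2a] := pselect (X1 a); last by exists 0%N => //; left.
  by have [k hk] := X1_open_box X1a; exists k => //; right.
move=> D _ FD; exists (\max_(u <- finmap.enum_fset D) u) => a /FD[k /= kD [?|ak]].
  by left.
by right; apply: open_boxS ak; exact: leq_bigmax_seq.
Qed.

(** Translation by -x maps this set into T_m and, thanks to the gap, is continuous
for tau on it. *)
Definition shift_domain m (d : R) x : set E :=
  [set a | [/\ X1 a, forall i, (m <= i)%N -> `|a i - x i| <= 2^-1 & gapset m x d a]].

Lemma closed_shift_domain m d x : closed (shift_domain m d x).
Proof.
rewrite -(setCK (shift_domain m d x)); apply: open_closedC.
rewrite (_ : ~` _ = @X2 R `|`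
  (\bigcup_(i in [set i | (m <= i)%N])
     [set a | X1 a /\ [set r : R | 2^-1 < `|r - x i|] (a i)] `|`
   \bigcup_(i in [set i | (0 < i < m)%N])
     [set a | X1 a /\ [set r : R | 2^-1 < `|r - x i| < 2^-1 + d] (a i)])).
  have cn i : continuous (fun r : R => `|r - x i|).
    by move=> r; apply: cvg_norm; apply: cvgB; [exact: cvg_id|exact: cvg_cst].
  apply: openU; first exact: open_X2.
  apply: openU; apply: bigcup_open => i _; apply: open_coord.
    have /continuousP/(_ _ (@open_gt R 2^-1)) := cn i; done.
  rewrite (_ : mkset _ = (fun r : R => `|r - x i|) @^-1` `]2^-1, 2^-1 + d[).
    by have /continuousP/(_ _ (@itv_open _ _ _ _)) := cn i; exact.
  by apply/seteqP; split => r /=; rewrite in_itv.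
apply/seteqP; split => a.
  move=> ga; have [X1a|] := pselect (X1 a); last by left.
  right; apply: contrapT => /not_orP[h1 h2]; apply: ga; split => //.
    move=> i mi; rewrite leNgt; apply/negP => hi; apply: h1; exists i => //; by split.
  move=> i hi; have [|h3] := leP `|a i - x i| 2^-1; first by left.
  have [|h4] := leP (2^-1 + d) `|a i - x i|; first by right.
  by exfalso; apply: h2; exists i => //; split => //=; rewrite h3.
case=> [X2a [X1a _ _]//|[[i mi [_ /= h]]|[i hi [_ /= /andP[h1 h2]]]] [_ g1 g2]].
  by have := g1 i mi; lra.
by case: (g2 i hi); lra.
Qed.

Lemma compact_preshift m (d : R) x F : (0 < m)%N -> 0 < d -> compact F ->
  F `<=` shift_domain m d x -> compact (preshift x F).
Proof.
move=> m0 d0 cF Fg; rewrite compact_ultra => U UU UF.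
pose f b := addE b x.
have VU : UltraFilter (f @ U) by exact: fmap_ultra.
move: cF; rewrite compact_ultra => /(_ _ VU UF)[p [Fp Vp]].
exists (addE p (oppE x)); split.
  by rewrite /preshift /= (_ : addE _ x = p)//; apply/funext => i; rewrite /addE /oppE subrK.
apply: (@gapped_cvg _ _ _ (preshift x F) m d) => //.
- move=> b /Fg[_ h _] i mi; have := h i mi; by rewrite /addE addrK.
- move=> b i /Fg[_ _ h] hi; have := h i hi; by rewrite /addE addrK.
move=> i e e0.
have /Vp : nbhs p [set a : E | X1 a /\ ball (p i) e (a i)].
  apply: open_nbhs_nbhs; split; first exact/open_coord/ball_open.
  by split; [have [] := Fg _ Fp|exact: ballxx].
rewrite /nbhs /=; apply: filterS => b [_]; rewrite /ball /= /f /addE /oppE distrC.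
by have -> : b i + x i - p i = b i - (p i - x i) by lra.
Qed.

Local Open Scope ereal_scope.

(** F is compact, hence inside a bounded box B up to X2. Outside [shift_domain] a
point of F is either within the gaps, or has a coordinate i >= m that leaves I;
both are small parts of B. *)
Lemma compact_preshift_approx x A F (e : R) :
  ell1 R x -> (0 < e)%R -> compact F -> F `<=` A ->
  exists F', [/\ compact F', F' `<=` preshift x A &
    lambda_outer F <= lambda_outer F' + e%:E].
Proof.
move=> lx e0 cF FA; have [k Fk] := compact_sub_open_box cF.
pose n := k.+1; pose B := box n (n%:R : R).
have kB : kcyl n B := kcyl_box _ _.
have Bfin : mu n B \is a fin_num by rewrite ge0_fin_numE ?mu_ge0// mu_box_fin.
pose V := fine (mu n B).
have V0 : (0 <= V)%R by rewrite fine_ge0// mu_ge0.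
have e0' : (0 < e / 2 / (V + 1))%R by rewrite !divr_gt0//; lra.
have [m nm hm] := ell1_tail n lx e0'.
have e2 : (0 < e / 2)%R by lra.
have [d d0 hd] := gap_small x (kcylW nm kB) (leqnn m) e2.
have m0 : (0 < m)%N by exact: leq_trans nm.
pose F'' := F `&` shift_domain m d x.
have cF'' : compact F'' by apply: compact_closedI => //; exact: closed_shift_domain.
exists (preshift x F''); split.
- by apply: (compact_preshift m0 d0 cF'') => a [].
- by move=> b [/FA].
rewrite lambda_outer_preshift//.
apply: le_trans (@lambda_outer_tail _ F (F'' `|` (B `\` gapset m x d))
  (fun i => slab B i (x i)) m V x V0 _ _) _.
- move=> a Fa; have [|ka] := Fk _ Fa; first by left.
  have Ba : B a by exact: open_box_box.
  have X1a : X1 a by exact: (@tail_X1 _ k.+1 _ ka.1).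
  right; have [h|h] := pselect (exists2 i, (m <= i)%N & ~ Iset (a i - x i)%R).
    by right; have [i mi hi] := h; exists i.
  left; have [g|g] := pselect (gapset m x d a); last by right; split.
  left; split => //; split => // i mi; apply/IsetE; apply: contrapT => hi.
  by apply: h; exists i.
- move=> i mi; rewrite fineK//; apply: lambda_outer_slab => //; exact: leq_trans mi.
have -> : (e%:E = (e / 2)%:E + (e / 2)%:E) by rewrite -EFinD; congr EFin; lra.
rewrite addeA; apply: leeD; last first.
  apply: le_trans (lee_wpmul2l _ hm) _ => //.
  rewrite -EFinM lee_fin mulrA ler_pdivrMr; last lra.
  by rewrite mulrC ler_wpM2l; lra.
apply: le_trans (lambda_outerU _ _) _; apply: leeD => //.
apply: le_trans hd.
have -> : B `\` gapset m x d = B `\` (tail m `&` gapset m x d).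
  apply/seteqP; split => a [Ba ga]; split => //; first by case.
  by move=> g; apply: ga; split => //; apply: (tailS nm); exact: kB.1.1.1.
apply: lambda_outer_diff => //; [exact: kcylW kB|exact: fcyl_gapset].
Qed.

Lemma lambda_inner_preshift_le x A : ell1 R x ->
  lambda_inner A <= lambda_inner (preshift x A).
Proof.
move=> lx; apply: ge_ereal_sup => _ [F [cF FA] <-].
apply/lee_addgt0Pr => e e0.
have [F' [cF' FA' h]] := compact_preshift_approx lx e0 cF FA.
apply: le_trans h _; apply: leeD => //; apply: ereal_sup_ubound.
by exists F'.
Qed.

Lemma lambda_inner_preshift x A : ell1 R x ->
  lambda_inner (preshift x A) = lambda_inner A.
Proof.
move=> lx; apply/eqP; rewrite eq_le lambda_inner_preshift_le// andbT.
rewrite -{2}(preshift_oppE x A); apply: lambda_inner_preshift_le; exact: ell1_oppE.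
Qed.

Lemma L0_preshift x A : ell1 R x -> L0 (preshift x A) <-> L0 A.
Proof. by move=> lx; rewrite /L0 /= lambda_outer_preshift// lambda_inner_preshift. Qed.

Lemma preshift_setI_oppE x A M :
  preshift x A `&` M = preshift x (A `&` preshift (oppE x) M).
Proof. by rewrite -{1}(preshift_oppE (oppE x) M) oppEK. Qed.

Lemma ell1_admissible x : ell1 R x -> admissible_translations R x.
Proof.
move=> lx A LA; rewrite translate_subE; split.
  move=> M LM; rewrite preshift_setI_oppE; apply/L0_preshift => //; apply: LA.
  by apply/L0_preshift => //; exact: ell1_oppE.
congr ereal_sup; apply/seteqP; split => _ [M LM <-].
  exists (preshift (oppE x) M); first by apply/L0_preshift => //; exact: ell1_oppE.
  by rewrite preshift_setI_oppE lambda_outer_preshift.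
exists (preshift x M); first by apply/L0_preshift.
by rewrite -[LHS]/(lambda_outer (preshift x (A `&` M))) lambda_outer_preshift.
Qed.

End InnerInvariance.

(** * Translations that are not summable *)

Section Necessity.
Context (R : realType).
Local Notation E := (Rinfty R).
Local Notation leb := (@lebesgue_measure R).
Implicit Types (a b l x : E) (S G A B C F M : set E) (n m k : nat).
Local Open Scope ereal_scope.

Lemma lambda_open_superadd G A :
  lambda_open (G `&` A) + lambda_open (G `\` A) <= lambda_open G.
Proof.
have [->|Gy] := eqVneq (lambda_open G) +oo; first exact: leey.
have Gf : lambda_open G \is a fin_num by rewrite ge0_fin_numE ?lambda_open_ge0// ltey.
have Af : lambda_open (G `&` A) \is a fin_num.
  rewrite ge0_fin_numE ?lambda_open_ge0//; apply: (@le_lt_trans _ _ (lambda_open G)).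
    by apply: lambda_openS => a [].
  by rewrite ltey.
rewrite addeC -leeBrDr//; apply: lambda_open_le => n S n0 kS SG.
rewrite leeBrDr// addeC -leeBrDr; last first.
  by rewrite ge0_fin_numE ?mu_ge0//; apply: mu_fin kS.2; exact: mcyl_kcyl.
apply: lambda_open_le => m T m0 kT TG; rewrite leeBrDr; last first.
  by rewrite ge0_fin_numE ?mu_ge0//; apply: mu_fin kS.2; exact: mcyl_kcyl.
rewrite -(muW (leq_maxl n m) (mcyl_kcyl kS)) -(muW (leq_maxr n m) (mcyl_kcyl kT)).
have kS' := kcylW (leq_maxl n m) kS; have kT' := kcylW (leq_maxr n m) kT.
rewrite addeC -muU; [|exact: mcyl_kcyl|exact: mcyl_kcyl|].
  apply: le_lambda_open; [by rewrite leq_max n0|exact: kcylU|].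
  by move=> a [/SG[]|/TG[]].
by apply/seteqP; split => // a [/SG[_ h] /TG[]].
Qed.

Lemma lambda_inner_le_outer A : lambda_inner A <= lambda_outer A.
Proof.
by apply: ge_ereal_sup => _ [F [cF FA] <-]; exact: le_lambda_outer.
Qed.

Lemma le_lambda_inner F A : compact F -> F `<=` A -> lambda_outer F <= lambda_inner A.
Proof. by move=> cF FA; apply: ereal_sup_ubound; exists F. Qed.

(** For A clopen, cutting with A preserves both open and compact sets, and the
error of approximation of M bounds that of its intersection with A by
superadditivity on disjoint open sets. *)
Lemma Linfty_clopen A : open A -> closed A -> Linfty A.
Proof.
move=> oA cA M [MM Mfin]; split; last first.
  by apply: le_lt_trans Mfin; apply: le_lambda_outer; exact: subIsetr.
apply/eqP; rewrite eq_le lambda_inner_le_outer andbT.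
apply/lee_addgt0Pr => e e0; have e2 : (0 < e / 2)%R by lra.
have [G [oG MG hG]] := lambda_outer_approx M e2.
have Mf : lambda_inner M \is a fin_num.
  by rewrite -MM ge0_fin_numE ?lambda_outer_ge0.
have [_ [F [cF FM] <-] hF] := ub_ereal_sup_adherent e2 Mf.
have {hF} GF : lambda_open G <= lambda_outer F + e%:E.
  have -> : (e%:E = (e / 2)%:E + (e / 2)%:E) by rewrite -EFinD; congr EFin; lra.
  apply: le_trans hG _; rewrite MM addeA leeD2r// -leeBlDr//; exact: ltW.
have Ff : lambda_outer F < +oo.
  by apply: le_lt_trans Mfin; exact: le_lambda_outer.
have GDf : lambda_open (G `\` A) \is a fin_num.
  rewrite ge0_fin_numE ?lambda_open_ge0//; apply: (@le_lt_trans _ _ (lambda_open G)).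
    by apply: lambda_openS => a [].
  by apply: le_lt_trans GF _; rewrite lte_add_pinfty// ltry.
have oGA : open (G `&` A) by exact: openI.
have oGD : open (G `\` A) by rewrite setDE; apply: openI => //; exact: closed_openC.
apply: (@le_trans _ _ (lambda_open (G `&` A))).
  apply: le_trans (lambda_outer_open oGA); apply: le_lambda_outer.
  by move=> a [Aa /MG].
apply: (@le_trans _ _ (lambda_outer (F `&` A) + e%:E)); last first.
  rewrite leeD2r//; apply: le_lambda_inner; first exact: compact_closedI.
  by move=> a [/FM].
rewrite -(leeD2rE _ _ GDf); apply: le_trans (lambda_open_superadd G A) _.
apply: le_trans GF _; rewrite [leRHS]addeAC leeD2r//.
rewrite -[X in lambda_outer X <= _](setUIDK F A).
apply: le_trans (lambda_outerU _ _) _; rewrite leeD2l//.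
apply: le_trans (lambda_outer_open oGD); apply: le_lambda_outer.
by move=> a [/FM/MG].
Qed.

Lemma clopen_tail1 : open (tail 1 : set E) /\ closed (tail 1 : set E).
Proof.
split; first exact: open_cyl (ocyl_tail _ _).
rewrite -(setCK (tail 1)); apply: open_closedC.
rewrite (_ : ~` _ = @X2 R `|` \bigcup_(i in [set i | (1 <= i)%N])
     [set a | X1 a /\ [set r : R | 2^-1 < `|r|]%R (a i)]).
  apply: openU; first exact: open_X2.
  apply: bigcup_open => i _; apply: open_coord.
  have /continuousP/(_ _ (@open_gt R 2^-1)) := @norm_continuous R R; exact.
apply/seteqP; split => a.
  move=> ta; have [X1a|] := pselect (X1 a); last by left.
  right; apply: contrapT => h; apply: ta => i i1; rewrite leNgt; apply/negP => hi.
  by apply: h; exists i.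
case=> [X2a /tail_X1//|[i i1 [_ /= h]] /(_ i i1)].
by rewrite leNgt h.
Qed.

Lemma kcyl_tail0 : kcyl 1 (tail 0 : set E).
Proof.
by apply: (@kcylW _ 0) => //; split; [exact: fcyl_tail|exists 0%R].
Qed.

Lemma mu_tail0 : mu 1 (tail 0 : set E) = 1.
Proof.
have k0 : kcyl 0 (tail 0 : set E) by split; [exact: fcyl_tail|exists 0%R].
rewrite (muW (leq0n 1) (mcyl_kcyl k0)).
rewrite -[LHS]/(\d_([tuple] : Rtuple R 0) (@pad R 0 @^-1` tail 0)) diracE mem_set//.
exact: tail_pad.
Qed.

Lemma lambda_outer_tail0 : lambda_outer (tail 0 : set E) = 1.
Proof.
apply/eqP; rewrite eq_le -mu_tail0; apply/andP; split.
  have := lambda_outer_diff (ltn0Sn 0) kcyl_tail0 (kcyl0 R 1).1.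
  by rewrite setD0.
apply: le_ereal_inf_tmp => _ [G [oG TG] <-].
exact: le_lambda_open kcyl_tail0 TG.
Qed.

(** As a cylinder of dimension 1, T_0 is gapped vacuously, hence compact. *)
Lemma L0_tail0 : L0 (tail 0 : set E).
Proof.
split; last by rewrite lambda_outer_tail0 ltry.
apply/eqP; rewrite eq_le lambda_inner_le_outer andbT; apply: le_lambda_inner => //.
by apply: (compact_gapped (d := 1%R) (ltn0Sn 0) kcyl_tail0) => // a i _; lia.
Qed.

Lemma lambda_infty_tail1 : 1 <= lambda_infty (tail 1 : set E).
Proof.
rewrite -lambda_outer_tail0; apply: ereal_sup_ubound; exists (tail 0).
  exact: L0_tail0.
by congr lambda_outer; apply/setIidr/tailS.
Qed.

(** The overlap of I and I + y has length at most 1 - |y|, or is empty;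
and 1 - |y| <= exp (- |y|). *)
Lemma leb_Iset_shiftI (y : R) :
  leb (@Iset R `&` [set r | @Iset R (r - y)%R]) <= (expR (- `|y|))%:E.
Proof.
have step (u v : R) : (v - u <= expR (- `|y|))%R -> 
    @Iset R `&` [set r | @Iset R (r - y)%R] `<=` `[u, v]%classic ->
    leb (@Iset R `&` [set r | @Iset R (r - y)%R]) <= (expR (- `|y|))%:E.
  move=> uv sub; apply: (@le_trans _ _ (leb `[u, v]%classic)).
    apply: le_measure; rewrite ?inE//; apply: measurableI.
      exact: measurable_Iset.
    exact: measurable_Iset_shift.
  rewrite lebesgue_measure_itv /= lte_fin; case: ifP => _.
    by rewrite -EFinB lee_fin.
  by rewrite lee_fin expR_ge0.
have h := expR_ge1Dx (- `|y|)%R; have [y0|y0] := leP 0%R y.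
  apply: (step (- 2^-1 + y)%R 2^-1%R).
    by rewrite ger0_norm// in h *; lra.
  by move=> r; rewrite /Iset /= !in_itv /= => -[]; lra.
apply: (step (- 2^-1)%R (2^-1 + y)%R).
  by rewrite ltr0_norm// in h *; lra.
by move=> r; rewrite /Iset /= !in_itv /= => -[]; lra.
Qed.

(** Built one coordinate at a time, so that [mu_prod] applies at each step. *)
Fixpoint window x n (B : set E) N : set E :=
  if N is N'.+1 then
    window x n B N' `&` [set b | @Iset R (b (n + N')%N + x (n + N')%N)%R]
  else B.

Lemma mu_window x n B N : kcyl n B ->
  kcyl (n + N) (window x n B N) /\
  mu (n + N) (window x n B N) <=
    mu n B * (expR (- \sum_(n <= i < n + N) `|x i|)%R)%:E.
Proof.
move=> kB; elim: N => [|N [kW IH]].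
  by rewrite addn0 big_geq// oppr0 expR0 mule1.
rewrite addnS; set m := (n + N)%N in kW IH *.
have WE : window x n B N.+1 = window x n B N `&`
    (tail m.+1 `&` [set a | @Iset R (a m - - x m)%R]).
  apply/seteqP; split => a /= [Wa ha]; rewrite opprK in ha *; split => //.
    by split => //; apply: (tailS (leqnSn m)); exact: kW.1.1.1.
  by case: ha.
split; first by rewrite WE; apply: kcylI; [exact: kcylW kW|exact: fcyl_Iset_shift].
pose J : set (measurableTypeR R) := @Iset R `&` [set r | @Iset R (r - - x m)%R].
have mJ : measurable J.
  by apply: measurableI; [exact: measurable_Iset|exact: measurable_Iset_shift].
have -> : window x n B N.+1 = cyl_prod m (window x n B N) J.
  rewrite (cyl_prodE kW.1.1); last by move=> r [].
  apply/seteqP; split => a /= [Wa ha]; rewrite /J /= opprK in ha *; split => //.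
    by split => //; apply/IsetE; exact: kW.1.1.1.
  by case: ha.
rewrite mu_prod//; last exact: mcyl_kcyl.
rewrite big_nat_recr/= ?leq_addr// -/m opprD expRD EFinM muleA.
apply: lee_pmul => //.
by rewrite -(normrN (x m)); exact: leb_Iset_shiftI.
Qed.

Lemma not_ell1_unbounded x n (c : R) : ~ ell1 R x ->
  exists N, (c <= \sum_(n <= i < n + N) `|x i|)%R.
Proof.
move=> nx; apply: contrapT => h; apply: nx.
have hN N : (\sum_(n <= i < n + N) `|x i| <= c)%R.
  by rewrite leNgt; apply/negP => /ltW hN; apply: h; exists N.
apply: (@le_lt_trans _ _ (\sum_(0 <= i < n) `|x i| + c)%R%:E); last exact: ltry.
apply: lime_le.
  by apply: is_cvg_nneseries => i _ _; rewrite lee_fin.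
exists n => // N /= nN; rewrite sumEFin lee_fin.
by rewrite (big_cat_nat (leq0n n) nN)/= lerD2l -(subnKC nN) hN.
Qed.

(** Within a bounded box of dimension n, the translate of T_1 is contained in all
the windows, whose measures tend to 0. *)
Lemma lambda_outer_preshift_tail1 x : ~ ell1 R x ->
  lambda_outer (preshift x (tail 1)) = 0.
Proof.
move=> nx; apply/eqP; rewrite eq_le lambda_outer_ge0 andbT.
have cover : preshift x (tail 1) `<=` @X2 R `|`
    \bigcup_k (box k.+1 k.+1%:R `&` preshift x (tail 1)).
  move=> b hb; have [X1b|] := pselect (X1 b); last by left.
  by have [k /open_box_box hk] := X1_open_box X1b; right; exists k.
apply: le_trans (le_lambda_outer cover) _; apply: le_trans (lambda_outerU _ _) _.
rewrite (lambda_outer_X2 (@subset_refl _ _)) add0e.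
apply: le_trans (lambda_outer_bigcup _) _; rewrite eseries0// => k _ _.
apply/eqP; rewrite eq_le lambda_outer_ge0 andbT.
apply/lee_addgt0Pr => e e0; rewrite add0e.
set n := k.+1; pose B : set E := box n (n%:R : R).
have kB : kcyl n B := kcyl_box _ _.
have Bfin : mu n B \is a fin_num by rewrite ge0_fin_numE ?mu_ge0// mu_box_fin.
pose V := fine (mu n B).
have V0 : (0 <= V)%R by rewrite fine_ge0// mu_ge0.
(* exp (- V / e) <= 1 / (1 + V / e), so V exp (- V / e) <= e *)
have [N hN] := not_ell1_unbounded n (V / e)%R nx.
have [kW hW] := mu_window x N kB.
have sub : B `&` preshift x (tail 1) `<=` window x n B N.
  move=> b [Bb tb]; elim: N {hN kW hW} => [//|N IH] /=; split => //.
  by apply/IsetE; apply: tb; rewrite /n addSn.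
apply: le_trans (le_lambda_outer sub) _.
apply: (@le_trans _ _ (mu (n + N) (window x n B N))).
  rewrite -(setD0 (window x n B N)).
  by apply: lambda_outer_diff => //; exact: (kcyl0 R _).1.
apply: le_trans hW _; rewrite -(fineK Bfin) -/V -EFinM lee_fin.
rewrite expRN ler_pdivrMr ?expR_gt0//.
apply: (@le_trans _ _ (e * (1 + V / e))%R).
  by rewrite mulrDr mulr1 mulrC divfK ?gt_eqF//; lra.
rewrite ler_pM2l//; apply: le_trans (expR_ge1Dx _); lra.
Qed.

Lemma admissible_ell1 x : admissible_translations R x -> ell1 R x.
Proof.
move=> ax; apply: contrapT => nx.
have [oT cT] := clopen_tail1.
have [_ h] := ax _ (Linfty_clopen oT cT).
suff : lambda_infty (tail 1 : set E) <= 0.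
  by move/(le_trans lambda_infty_tail1); rewrite lee_fin ler10.
rewrite -h translate_subE; apply: ge_ereal_sup => _ [M LM <-].
rewrite -(lambda_outer_preshift_tail1 nx); apply: le_lambda_outer; exact: subIsetl.
Qed.

End Necessity.

Theorem theorem2p26 (R : realType) : admissible_translations R = ell1 R.
Proof.
apply/seteqP; split => x; [exact: admissible_ell1|exact: ell1_admissible].
Qed.
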